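(* Let $(\mathcal{E},D[\mathcal{E}])$ be a positive, transient, regular semi-Dirichlet form on $L^2(E;m)$, let $\mathbb{X}$ be the Hunt process associated with it, let $\mathcal{F}_e$ be its extended domain, and let $\mathcal{P}\subset\mathcal{B}^{r,+}(E)$ be a family satisfying (P1) and (P2). Assume that $(\mathbb{X},\mathcal{P},m)$ has the compactness property. If $\{u_n\}\subset\mathcal{F}_e\cap\mathcal{P}$ and $$\sup_{n\ge1}\mathcal{E}(u_n,u_n)<\infty,$$ then there exists a subsequence $(n')\subset(n)$ such that $\{u_{n'}\}$ converges $m$-a.e. and its limit is $m$-a.e. finite.
   Context: Semi-Dirichlet forms. As usual in the theory of regular forms, $E$ is a locally compact separable metric space and $m$ a positive Radon measure on $E$ with full support. Write $\mathcal{E}_\alpha(u,v)=\mathcal{E}(u,v)+\alpha(u,v)_{L^2(E;m)}$. A semi-Dirichlet form on $L^2(E;m)$ is a bilinear form $\mathcal{E}$ on a dense linear subspace $D[\mathcal{E}]\subset L^2(E;m)$ such that: (a) there is $\alpha_0\ge0$ with $\mathcal{E}_\alpha(u,u)\ge0$ for $u\in D[\mathcal{E}]$, $\alpha\ge\alpha_0$; (b) there is $K>0$ with $|\mathcal{E}(u,v)|\le K\mathcal{E}_{\alpha_0}(u,u)^{1/2}\mathcal{E}_{\alpha_0}(v,v)^{1/2}$; (c) $D[\mathcal{E}]$ with the inner product $\mathcal{E}^{(s)}_{\alpha_0}(u,v)=\frac12(\mathcal{E}_{\alpha_0}(u,v)+\mathcal{E}_{\alpha_0}(v,u))$ is a Hilbert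 space; (d) for $u\in D[\mathcal{E}]$, $k\ge0$: $u\wedge k\in D[\mathcal{E}]$ and $\mathcal{E}(u\wedge k,u\wedge k)\le\mathcal{E}(u\wedge k,u)$. It is regular if some $\mathcal{C}\subset C_0(E)\cap D[\mathcal{E}]$ ($C_0(E)$: continuous functions with compact support) is dense in $D[\mathcal{E}]$ in the $\mathcal{E}_{\alpha_0}$-norm and in $C_0(E)$ uniformly. With every regular semi-Dirichlet form there is associated a Hunt process $\mathbb{X}=(\{X_t\},\{P_x\})$ on $E$ with cemetery $\Delta$, whose transition semigroup represents the $L^2$-semigroup of the form. The form is positive if (a) holds with $\alpha_0=0$. It is transient if there is a strictly positive Borel function $f$ on $E$ with $R_0f<\infty$ $m$-a.e. Extended domain. For a positive transient form there is an extension $\mathcal{F}_e\supset D[\mathcal{E}]$ (the extended space: classes of $m$-a.e. finite measurable functions $u$ which are $m$-a.e. limits of $\mathcal{E}$-Cauchy sequences from $D[\mathcal{E}]$), to which $\mathcal{E}$ extends, such that $(\mathcal{F}_e,\mathcal{E}^{(s)})$, with $\mathcal{E}^{(s)}(u,v)=\frac12(\mathcal{E}(u,v)+\mathcal{E}(v,u))$, is a Hilbert space. Notation. $\mathcal{B}^+(E)$: nonnegative numerical Borel functions; $\mathcal{B}^{r,+}(E)$: nonnegative real-valued Borel functions; functions are extended by $f(\Delta)=0$; $R_\alpha f(x)=E_x\int_0^\infty e^{-\alpha t}f(X_t)\,dt$. (P1): $f\in\mathcal{P}$, $g\in\mathcal{B}^+(E)$, $g\le f$ imply $g\in\mathcal{P}$.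 (P2): $\{f_n\}_{n\ge1}\subset\mathcal{P}$ implies $\sup_nf_n\in\mathcal{P}$. Compactness property. $(\mathbb{X},\mathcal{P},m)$ has the compactness property if for every sequence $\{u_n\}\subset\mathcal{P}$ there exist $\Lambda\subset(0,\infty)$ with $\sup\Lambda=+\infty$ and a subsequence $(n')\subset(n)$ such that for every $\alpha\in\Lambda$ the sequence $\{R_\alpha u_{n'}\}$ converges $m$-a.e. and its limit is $m$-a.e. finite. *)

(* Defs.v *)
From HB Require Import structures.
From mathcomp Require Import all_boot all_order all_algebra.
From mathcomp Require Import all_classical all_reals all_analysis.
From mathcomp Require Import measurable_realfun.

Set Implicit Arguments.
Unset Strict Implicit.
Unset Printing Implicit Defensive.

Import Order.TTheory GRing.Theory Num.Theory.
Import numFieldNormedType.Exports.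

Local Open Scope classical_set_scope.
Local Open Scope ring_scope.

(* Measurable types are pointed in the library, hence so is the state space. *)
#[short(type="pmetricType")]
HB.structure Definition PointedMetric (K : numDomainType) :=
  { M of Pointed M & Metric K M }.

Notation borel T := (g_sigma_algebraType (@open T)).

(* E together with the cemetery None: the point at infinity of E, which is
   isolated if E is compact. *)
Notation cemetery_ext T := (one_point_compactification T).

Section StateSpace.
Context {R : realType} {E : pmetricType R}.
Implicit Types (m : {measure set (borel E) -> \bar R}).

Definition lcs_space : Prop :=
  locally_compact [set: E] /\ exists2 S : set E, countable S & dense S.

Record radon_measure m : Prop := {
  radon_compact : forall K : set E, compact K -> (m K < +oo)%E;
  radon_inner_regular : forall A : set (borel E), measurable A ->
    m A = ereal_sup [set m K | K in [set K : set E | compact K /\ K `<=` A]] }.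

Definition full_support m : Prop :=
  forall U : set E, open U -> U !=set0 -> (0 < m U)%E.

End StateSpace.

Arguments lcs_space {R} E.

(* Elements of spaces of m-classes are represented by real-valued Borel
   functions; sets of such functions and forms on them are required to be
   invariant under m-a.e. equality. *)
Section Forms.
Context {R : realType} {E : pmetricType R}.
Variable m : {measure set (borel E) -> \bar R}.
Implicit Types (u v w f : E -> R) (V D : set (E -> R)).
Implicit Types (B : (E -> R) -> (E -> R) -> R).

Definition L2 : set (E -> R) :=
  [set u | (u : borel E -> R) \in Lfun m 2%:E].

Definition L2dist u v : \bar R := 'N[m]_2%:E[EFin \o (u \- v)].

Definition L2dot u v : R := \int[m]_x (u x * v x).

Record bilinear_form V B : Prop := {
  bf_measurable : forall u, V u -> measurable_fun [set: borel E] u;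
  bf_dom0 : V (fun=> 0);
  bf_dom_linear : forall (a : R) u v, V u -> V v ->
    V (fun x => a * u x + v x);
  bf_dom_ae : forall u v, V u -> measurable_fun [set: borel E] v ->
    {ae m, forall x, u x = v x} -> V v;
  bf_linearl : forall (a : R) u v w, V u -> V v -> V w ->
    B (fun x => a * u x + v x) w = a * B u w + B v w;
  bf_linearr : forall (a : R) u v w, V u -> V v -> V w ->
    B w (fun x => a * u x + v x) = a * B w u + B w v;
  bf_ae : forall u u' v v', V u -> V u' -> V v -> V v' ->
    {ae m, forall x, u x = u' x} -> {ae m, forall x, v x = v' x} ->
    B u v = B u' v' }.

Definition sym_form B : (E -> R) -> (E -> R) -> R :=
  fun u v => 2^-1 * (B u v + B v u).

Definition form_cvg B (w : nat -> E -> R) u : Prop :=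
  B (w n \- u) (w n \- u) @[n --> \oo] --> 0.

Definition form_cauchy B (w : nat -> E -> R) : Prop :=
  forall e : R, 0 < e -> exists N : nat, forall i j, (N <= i)%N -> (N <= j)%N ->
    B (w i \- w j) (w i \- w j) < e.

(* B is symmetric bilinear wherever this is used. *)
Record hilbert_space V B : Prop := {
  hilbert_ge0 : forall u, V u -> 0 <= B u u;
  hilbert_eq0 : forall u, V u -> B u u = 0 -> {ae m, forall x, u x = 0};
  hilbert_complete : forall w : nat -> E -> R, (forall n, V (w n)) ->
    form_cauchy B w -> exists2 u, V u & form_cvg B w u }.

Definition form_shift B (a : R) : (E -> R) -> (E -> R) -> R :=
  fun u v => B u v + a * L2dot u v.

Definition lower_bounded D B (a0 : R) : Prop :=
  forall u (a : R), D u -> a0 <= a -> 0 <= form_shift B a u u.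

Record semi_dirichlet_form D B (a0 : R) : Prop := {
  sdf_sub_L2 : D `<=` L2;
  sdf_dense : forall f, L2 f -> forall e : R, 0 < e ->
    exists2 u, D u & (L2dist f u < e%:E)%E;
  sdf_bilinear : bilinear_form D B;
  sdf_a0_ge0 : 0 <= a0;
  sdf_lower_bounded : lower_bounded D B a0;
  sdf_sector : exists2 K : R, 0 < K & forall u v, D u -> D v ->
    `|B u v| <= K * Num.sqrt (form_shift B a0 u u)
                  * Num.sqrt (form_shift B a0 v v);
  sdf_hilbert : hilbert_space D (sym_form (form_shift B a0));
  sdf_contraction : forall u (k : R), D u -> 0 <= k ->
    let uk := fun x => Num.min (u x) k in D uk /\ B uk uk <= B uk u }.

Definition positive_form D B : Prop := lower_bounded D B 0.

Definition Cc : set (E -> R) :=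
  [set f : E -> R | continuous f /\ compact (closure [set x | f x != 0])].

Definition regular_form D B (a0 : R) : Prop :=
  exists C : set (E -> R), [/\ C `<=` Cc `&` D,
    forall u, D u -> forall e : R, 0 < e ->
      exists2 w, C w & form_shift B a0 (u \- w) (u \- w) < e &
    forall f, Cc f -> forall e : R, 0 < e ->
      exists2 w, C w & forall x, `|f x - w x| < e].

(* The resolvent of the form is G_a f, a > a0, determined by
   B_a (G_a f) v = (f, v) for v in D; T is the semigroup whose (weak) Laplace
   transform is G_a. *)
Record form_semigroup D B (a0 : R) (T : R -> (E -> R) -> E -> R) : Prop := {
  fsg_L2 : forall t f, 0 <= t -> L2 f -> L2 (T t f);
  fsg_linear : forall t (a : R) f g, 0 <= t -> L2 f -> L2 g ->
    {ae m, forall x, T t (fun y => a * f y + g y) x = a * T t f x + T t g x};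
  fsg_bounded : forall t f, 0 <= t -> L2 f ->
    ('N[m]_2%:E[EFin \o T t f] <=
      (expR (a0 * t))%:E * 'N[m]_2%:E[EFin \o f])%E;
  fsg_id : forall f, L2 f -> {ae m, forall x, T 0 f x = f x};
  fsg_semigroup : forall s t f, 0 <= s -> 0 <= t -> L2 f ->
    {ae m, forall x, T (s + t) f x = T s (T t f) x};
  fsg_continuous : forall f, L2 f ->
    L2dist (T t f) f @[t --> 0^'+] --> 0%E;
  fsg_resolvent : forall (a : R) f, a0 < a -> L2 f -> exists Gaf,
    [/\ D Gaf,
      forall v, D v -> form_shift B a Gaf v = L2dot f v &
      forall h, L2 h -> L2dot Gaf h =
        \int[lebesgue_measure]_(t in `[0, +oo[) (expR (- a * t) * L2dot (T t f) h)] }.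

Definition approximates D B (w : nat -> E -> R) u : Prop :=
  [/\ forall n, D (w n), form_cauchy B w &
      {ae m, forall x, w n x @[n --> \oo] --> u x}].

(* An m-a.e. finite class has a real-valued representative. *)
Definition extended_space D B : set (E -> R) :=
  [set u : E -> R | measurable_fun [set: borel E] u /\
    exists w : nat -> E -> R, approximates D B w u].

(* Be is the continuous extension of B to the extended space. It is uniquely
   determined: by ef_approx, ef_extends and ef_bounded, Be u v is the limit of
   B (wu n) (wv n) whenever wu approximates u and wv approximates v. *)
Record extended_form D B (Be : (E -> R) -> (E -> R) -> R) : Prop := {
  ef_bilinear : bilinear_form (extended_space D B) Be;
  ef_extends : forall u v, D u -> D v -> Be u v = B u v;
  ef_hilbert : hilbert_space (extended_space D B) (sym_form Be);
  ef_bounded : exists K : R, forall u v,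
    extended_space D B u -> extended_space D B v ->
    `|Be u v| <= K * Num.sqrt (Be u u) * Num.sqrt (Be v v);
  ef_approx : forall (w : nat -> E -> R) u, extended_space D B u ->
    approximates D B w u -> form_cvg Be w u }.

End Forms.

Section HuntProcess.
Context {R : realType} {E : pmetricType R}.
Context {d : measure_display} {Omega : measurableType d}.
Local Notation Ed := (cemetery_ext E).
Variables (X : R -> Omega -> Ed) (P : Ed -> probability Omega R).
Variable F : R -> set (set Omega).

(* The time set is [0, +oo[; values of X and F at negative times are never
   used. *)

Definition stopping_time (tau : Omega -> \bar R) : Prop :=
  (forall w, 0 <= tau w)%E /\
  forall t : R, 0 <= t -> F t [set w | (tau w <= t%:E)%E].

Definition stopped_events (tau : Omega -> \bar R) : set (set Omega) :=
  [set A | measurable A /\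
    forall t : R, 0 <= t -> F t (A `&` [set w | (tau w <= t%:E)%E])].

(* The strong Markov property and quasi-left-continuity are restricted to
   finite values of the stopping times, which amounts to X_oo = cemetery.
   The simple Markov property is the case of constant stopping times. *)
Record hunt_process : Prop := {
  hp_filtration : forall t : R, 0 <= t ->
    sigma_algebra [set: Omega] (F t) /\ F t `<=` measurable;
  hp_filtration_le : forall s t : R, 0 <= s -> s <= t -> F s `<=` F t;
  hp_filtration_right : forall (t : R) A, 0 <= t ->
    (forall s : R, t < s -> F s A) -> F t A;
  hp_adapted : forall (t : R) (A : set (borel Ed)), 0 <= t -> measurable A ->
    F t (X t @^-1` A);
  hp_kernel : forall (t : R) (A : set (borel Ed)), 0 <= t -> measurable A ->
    measurable_fun [set: borel Ed]
      (fun x => P x (X t @^-1` A));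
  hp_normal : forall x : Ed, P x (X 0 @^-1` [set x]) = 1%E;
  hp_cemetery : forall (s t : R) w, 0 <= s -> s <= t -> X s w = None -> X t w = None;
  hp_shift : exists theta : R -> Omega -> Omega,
    forall (s t : R) w, 0 <= s -> 0 <= t -> X s (theta t w) = X (s + t) w;
  hp_right_continuous : forall (t : R) w, 0 <= t -> X s w @[s --> t^'+] --> X t w;
  hp_left_limits : forall (t : R) w, 0 < t -> cvg (X s w @[s --> t^'-]);
  hp_strong_markov : forall tau, stopping_time tau ->
    forall A, stopped_events tau A ->
    forall (x : Ed) (s : R) (B : set (borel Ed)), 0 <= s -> measurable B ->
    let A' := A `&` [set w | (tau w < +oo)%E] in
    P x (A' `&` [set w | B (X (fine (tau w) + s) w)]) =
      (\int[P x]_(w in A') P (X (fine (tau w)) w) (X s @^-1` B))%E;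
  hp_quasi_left_continuous :
    forall (tau_ : nat -> Omega -> \bar R) (tau : Omega -> \bar R),
    (forall n, stopping_time (tau_ n)) ->
    (forall w, nondecreasing_seq (tau_ ^~ w)) ->
    (forall w, tau_ n w @[n --> \oo] --> tau w) ->
    forall x : Ed, {ae P x, forall w, (tau w < +oo)%E ->
      X (fine (tau_ n w)) w @[n --> \oo] --> X (fine (tau w)) w} }.

Definition ext0 (f : E -> \bar R) (z : Ed) : \bar R :=
  if z is Some x then f x else 0%E.

Definition resolvent (a : R) (f : E -> \bar R) (x : E) : \bar R :=
  (\int[P (Some x)]_w \int[lebesgue_measure]_(t in `[0%R, +oo[)
     ((expR (- a * t))%:E * ext0 f (X t w)))%E.

Definition transition (t : R) (f : E -> \bar R) (x : E) : \bar R :=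
  (\int[P (Some x)]_w ext0 f (X t w))%E.

Variable m : {measure set (borel E) -> \bar R}.

Definition associated (D : set (E -> R)) B (a0 : R) : Prop :=
  exists2 T, form_semigroup m D B a0 T &
    forall t (f : E -> R), 0 < t -> L2 m f ->
      (exists M : R, forall x, `|f x| <= M) ->
      {ae m, forall x, transition t (EFin \o f) x = (T t f x)%:E}.

Definition transient : Prop :=
  exists f : E -> R, [/\ measurable_fun [set: borel E] f,
    forall x, 0 < f x &
    {ae m, forall x, (resolvent 0 (EFin \o f) x < +oo)%E}].

Definition ae_cvg_finite (f : nat -> E -> \bar R) : Prop :=
  {ae m, forall x, cvg (f n x @[n --> \oo]) /\
                   lim (f n x @[n --> \oo]) \is a fin_num}.

Definition compactness_property (PP : set (E -> \bar R)) : Prop :=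
  forall u : nat -> E -> \bar R, (forall n, PP (u n)) ->
  exists (Lambda : set R) (phi : nat -> nat),
    [/\ Lambda `<=` [set a | 0 < a],
        ereal_sup [set a%:E | a in Lambda] = +oo%E,
        {homo phi : i j / (i < j)%N} &
        forall a, Lambda a ->
          ae_cvg_finite (fun n => resolvent a (u (phi n)))].

End HuntProcess.

Section Families.
Context {R : realType} {E : pmetricType R}.
Implicit Types (PP : set (E -> \bar R)) (f g : E -> \bar R).

Definition nonneg_borel : set (E -> \bar R) :=
  [set f | measurable_fun [set: borel E] f /\ forall x, (0 <= f x)%E].

Definition nonneg_borel_real : set (E -> \bar R) :=
  [set f | nonneg_borel f /\ forall x, f x \is a fin_num].

Definition property_P1 PP : Prop := forall f g, PP f -> nonneg_borel g ->
  (forall x, (g x <= f x)%E) -> PP g.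

Definition property_P2 PP : Prop := forall f_ : nat -> E -> \bar R,
  (forall n, PP (f_ n)) -> PP (fun x => ereal_sup (range (f_ ^~ x))).

End Families.

(* Main.v *)
(** Put [v_n := min(u_n, rho)] with [rho] bounded, nonnegative and in the domain.
    By [B(a G_a z, w) = a (z - a G_a z, w)], positivity and the sector condition,
    [a |z - a G_a z|^2 <= B(a G_a z, z) <= K B(z, z)] for [z] in the domain.  Since
    [v_n] is an [L2]-limit of domain elements of energy bounded uniformly in [n], the
    functions [v_n] are within [O(a^-1/2)] of [a G_a v_n], uniformly in [n].  By the
    compactness property [R_a v_n = G_a v_n] converges a.e. along a subsequence for
    arbitrarily large [a], hence in [L2] by domination by [G_a rho]; so the
    subsequence of [v_n] is Cauchy in [L2] and has an a.e. convergent subsequence.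
    Finally, [sup_n u_n] is finite everywhere by (P2), so choosing countably many
    [rho] whose supremum is infinite and passing to a diagonal subsequence removes
    the truncation. *)

From HB Require Import structures.
Require Import Defs.
From mathcomp Require Import all_boot all_order all_algebra.
From mathcomp Require Import all_classical all_reals all_analysis.
From mathcomp Require Import measurable_realfun.
From mathcomp Require Import ring lra.
Import Order.TTheory GRing.Theory Num.Theory.
Import numFieldNormedType.Exports.
Local Open Scope classical_set_scope.
Local Open Scope ring_scope.

Set Implicit Arguments.
Unset Strict Implicit.
Unset Printing Implicit Defensive.

(** * Square integrable functions *)

(** The compactness property concerns the process and the estimates concern the form. [associated]
    links them only through [T t f] for each fixed [t], outside a null set that depends on [t].
    Identifying the two resolvents therefore needs an integration over time and space, hence
    Tonelli, hence joint measurability of the transition function and sigma-finiteness of [m], both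
    of which have to be derived. The first comes from right-continuity of the paths, which settles
    continuous functions, followed by a Dynkin argument; the second from bump functions in the
    domain, whose multiples also serve as the functions [rho].

    On the form side, [sdf_sector] bounds [B] by the shifted form, but sequences approximating
    elements of the extended space have no controlled L2 norm. The sector bound by [B] alone is
    taken from [ef_bounded] instead. *)

Section AlmostEverywhere.
Context {R : realType} {E : pmetricType R}.
Variable m : {measure set (borel E) -> \bar R}.

Lemma ae_imp (P Q : E -> Prop) : (forall x, P x -> Q x) ->
  {ae m, forall x, P x} -> {ae m, forall x, Q x}.
Proof.
by move=> PQ; exact: (@filterS (borel E) _ (ae_filter_ringOfSetsType m) P Q PQ).
Qed.

Lemma ae_imp2 (P Q S : E -> Prop) : (forall x, P x -> Q x -> S x) ->
  {ae m, forall x, P x} -> {ae m, forall x, Q x} -> {ae m, forall x, S x}.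
Proof.
by move=> PQ; exact: (@filterS2 (borel E) _ (ae_filter_ringOfSetsType m) P Q S PQ).
Qed.

End AlmostEverywhere.

Section SquareIntegrable.
Context {R : realType} {E : pmetricType R}.
Variable m : {measure set (borel E) -> \bar R}.
Implicit Types f g h : E -> R.

Lemma L2_measurable f : L2 m f -> measurable_fun [set: borel E] f.
Proof. by rewrite /L2/= inE => /andP[/[!inE]]. Qed.

Lemma L2_mul_integrable f g : L2 m f -> L2 m g ->
  m.-integrable [set: borel E] (EFin \o (fun x => f x * g x)).
Proof. by move=> lf lg; apply/Lfun1_integrable; exact: Lfun2_mul_Lfun1. Qed.

Lemma L2_of_integrable_sqr f : measurable_fun [set: borel E] f ->
  m.-integrable [set: borel E] (EFin \o (fun x => f x * f x)) -> L2 m f.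
Proof.
move=> mf /integrableP[_ fi]; rewrite /L2/= inE; apply/andP; split.
  by rewrite inE.
rewrite inE/= /finite_norm unlock /= poweR_lty//.
apply: le_lt_trans fi; rewrite le_eqVlt; apply/orP; left; apply/eqP.
apply: eq_integral => x _ /=.
by rewrite -expr2 normrX powR_mulrn.
Qed.

Lemma L2_le f g : measurable_fun [set: borel E] f -> L2 m g ->
  (forall x, `|f x| <= `|g x|) -> L2 m f.
Proof.
move=> mf lg fg; apply: L2_of_integrable_sqr => //.
apply: (le_integrable measurableT _ _ (L2_mul_integrable lg lg)) => //.
  by apply/measurable_EFinP; exact: measurable_funM.
by move=> x _ /=; rewrite lee_fin !normrM ler_pM.
Qed.

Lemma L2_linear (a : R) f g : L2 m f -> L2 m g -> L2 m (fun x => a * f x + g x).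
Proof.
move=> lf lg.
have := Lfun_submod_closed m (lee1n 2); case=> _ /(_ a f g lf lg).
by [].
Qed.

Lemma L2D f g : L2 m f -> L2 m g -> L2 m (f \+ g).
Proof.
move=> lf lg; rewrite (_ : f \+ g = fun x => 1 * f x + g x).
  exact: L2_linear.
by apply/funext => x /=; rewrite mul1r.
Qed.

Lemma L2B f g : L2 m f -> L2 m g -> L2 m (f \- g).
Proof.
move=> lf lg; rewrite (_ : f \- g = fun x => -1 * g x + f x).
  exact: L2_linear.
by apply/funext => x /=; rewrite mulN1r addrC.
Qed.

Lemma L2Z (a : R) f : L2 m f -> L2 m (fun x => a * f x).
Proof.
move=> lf; rewrite (_ : (fun x => _) = fun x => (a - 1) * f x + f x).
  exact: L2_linear.
by apply/funext => x /=; rewrite mulrBl mul1r subrK.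
Qed.

Lemma L2dotC f g : L2dot m f g = L2dot m g f.
Proof. by apply: eq_Rintegral => x _; rewrite mulrC. Qed.

Lemma L2dot_linearl (a : R) f g h : L2 m f -> L2 m g -> L2 m h ->
  L2dot m (fun x => a * f x + g x) h = a * L2dot m f h + L2dot m g h.
Proof.
move=> lf lg lh; rewrite /L2dot.
rewrite -RintegralZl//; last exact: L2_mul_integrable.
rewrite -RintegralD//; first 1 last.
- rewrite (_ : _ \o _ = EFin \o (fun x => (a * f x) * h x)).
    by apply: L2_mul_integrable => //; exact: L2Z.
  by apply/funext => x /=; rewrite mulrA.
- exact: L2_mul_integrable.
by apply: eq_Rintegral => x _; rewrite mulrDl mulrA.
Qed.

Lemma L2dotDl f g h : L2 m f -> L2 m g -> L2 m h ->
  L2dot m (f \+ g) h = L2dot m f h + L2dot m g h.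
Proof.
move=> lf lg lh; rewrite -[L2dot m f h]mul1r -L2dot_linearl//.
by apply: eq_Rintegral => x _ /=; rewrite mul1r.
Qed.

Lemma L2dotBl f g h : L2 m f -> L2 m g -> L2 m h ->
  L2dot m (f \- g) h = L2dot m f h - L2dot m g h.
Proof.
move=> lf lg lh; rewrite addrC -mulN1r -L2dot_linearl//.
by apply: eq_Rintegral => x _ /=; rewrite mulN1r addrC.
Qed.

Lemma L2dotZl (a : R) f h : L2 m f -> L2 m h ->
  L2dot m (fun x => a * f x) h = a * L2dot m f h.
Proof.
move=> lf lh; rewrite /L2dot -RintegralZl//; last exact: L2_mul_integrable.
by apply: eq_Rintegral => x _ /=; rewrite mulrA.
Qed.

Lemma L2dot_ge0 f : 0 <= L2dot m f f.
Proof. by apply: Rintegral_ge0 => x _; rewrite -expr2 sqr_ge0. Qed.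

(** This is the parallelogram law with the square of [f \- g] dropped. It keeps the later L2
    estimates free of square roots, at the price of factors 2. *)
Lemma L2dot_sqr_add f g : L2 m f -> L2 m g ->
  L2dot m (f \+ g) (f \+ g) <= 2 * L2dot m f f + 2 * L2dot m g g.
Proof.
move=> lf lg.
have := L2dot_ge0 (f \- g).
have lB := L2B lf lg; have lD := L2D lf lg.
rewrite (L2dotBl lf lg lB) (L2dotDl lf lg lD) !(L2dotC _ (f \+ g)) !(L2dotC _ (f \- g)).
rewrite !(L2dotBl lf lg)// !(L2dotDl lf lg)// (L2dotC g f); lra.
Qed.

Lemma L2dot_sqr_sub f g : L2 m f -> L2 m g ->
  L2dot m (f \- g) (f \- g) <= 2 * L2dot m f f + 2 * L2dot m g g.
Proof.
move=> lf lg.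
have := L2dot_ge0 (f \+ g).
have lB := L2B lf lg; have lD := L2D lf lg.
rewrite (L2dotBl lf lg lB) (L2dotDl lf lg lD) !(L2dotC _ (f \+ g)) !(L2dotC _ (f \- g)).
rewrite !(L2dotBl lf lg)// !(L2dotDl lf lg)// (L2dotC g f); lra.
Qed.

Lemma L2dot_sqrZ (a : R) f : L2 m f ->
  L2dot m (fun x => a * f x) (fun x => a * f x) = a ^+ 2 * L2dot m f f.
Proof.
move=> lf; have laf := L2Z a lf.
by rewrite (L2dotZl a lf laf) L2dotC L2dotZl// mulrA -expr2.
Qed.

End SquareIntegrable.

(** * Positive forms and their resolvents *)

Section BilinearForm.
Context {R : realType} {E : pmetricType R}.
Variable m : {measure set (borel E) -> \bar R}.
Variables (V : set (E -> R)) (B : (E -> R) -> (E -> R) -> R).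
Hypothesis HB : bilinear_form m V B.
Implicit Types u v w : E -> R.

Lemma form_domD u v : V u -> V v -> V (u \+ v).
Proof.
move=> Vu Vv; rewrite (_ : u \+ v = fun x => 1 * u x + v x).
  exact: (bf_dom_linear HB).
by apply/funext => x /=; rewrite mul1r.
Qed.

Lemma form_domZ (a : R) u : V u -> V (fun x => a * u x).
Proof.
move=> Vu; rewrite (_ : (fun x => _) = fun x => (a - 1) * u x + u x).
  exact: (bf_dom_linear HB).
by apply/funext => x /=; rewrite mulrBl mul1r subrK.
Qed.

Lemma form_domB u v : V u -> V v -> V (u \- v).
Proof.
move=> Vu Vv; rewrite (_ : u \- v = fun x => -1 * v x + u x).
  exact: (bf_dom_linear HB).
by apply/funext => x /=; rewrite mulN1r addrC.
Qed.

Lemma formDl u v w : V u -> V v -> V w -> B (u \+ v) w = B u w + B v w.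
Proof.
move=> Vu Vv Vw; rewrite (_ : u \+ v = fun x => 1 * u x + v x).
  by rewrite (bf_linearl HB)// mul1r.
by apply/funext => x /=; rewrite mul1r.
Qed.

Lemma formDr u v w : V u -> V v -> V w -> B w (u \+ v) = B w u + B w v.
Proof.
move=> Vu Vv Vw; rewrite (_ : u \+ v = fun x => 1 * u x + v x).
  by rewrite (bf_linearr HB)// mul1r.
by apply/funext => x /=; rewrite mul1r.
Qed.

Lemma formBl u v w : V u -> V v -> V w -> B (u \- v) w = B u w - B v w.
Proof.
move=> Vu Vv Vw; rewrite (_ : u \- v = fun x => -1 * v x + u x).
  by rewrite (bf_linearl HB)// mulN1r addrC.
by apply/funext => x /=; rewrite mulN1r addrC.
Qed.

Lemma formBr u v w : V u -> V v -> V w -> B w (u \- v) = B w u - B w v.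
Proof.
move=> Vu Vv Vw; rewrite (_ : u \- v = fun x => -1 * v x + u x).
  by rewrite (bf_linearr HB)// mulN1r addrC.
by apply/funext => x /=; rewrite mulN1r addrC.
Qed.

Lemma form_zero w : V w -> B (fun=> 0) w = 0.
Proof.
move=> Vw; have V0 := bf_dom0 HB.
rewrite -[RHS](subrr (B (fun=> 0) w)) -(formBl V0 V0 Vw); congr (B _ _).
by apply/funext => x /=; rewrite subr0.
Qed.

Lemma formZl (a : R) u w : V u -> V w -> B (fun x => a * u x) w = a * B u w.
Proof.
move=> Vu Vw; have V0 := bf_dom0 HB.
rewrite -[RHS]addr0 -(form_zero Vw) -(bf_linearl HB a Vu V0 Vw); congr (B _ _).
by apply/funext => x /=; rewrite addr0.
Qed.

Hypothesis B_ge0 : forall u, V u -> 0 <= B u u.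

(** The cross terms [B u v] and [B v u] occur together, so positivity on the difference controls
    them although [B] is not symmetric. *)
Lemma form_sqr_add u v : V u -> V v -> B (u \+ v) (u \+ v) <= 2 * B u u + 2 * B v v.
Proof.
move=> Vu Vv.
have VB := form_domB Vu Vv.
have VD := form_domD Vu Vv.
have := B_ge0 VB.
rewrite (formBl Vu Vv VB) (formDl Vu Vv VD) !(formBr Vu Vv)// !(formDr Vu Vv)//.
by lra.
Qed.

Lemma form_sqr_sub u v : V u -> V v -> B (u \- v) (u \- v) <= 2 * B u u + 2 * B v v.
Proof.
move=> Vu Vv.
have VB := form_domB Vu Vv.
have VD := form_domD Vu Vv.
have := B_ge0 VD.
rewrite (formBl Vu Vv VB) (formDl Vu Vv VD) !(formBr Vu Vv)// !(formDr Vu Vv)//.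
by lra.
Qed.

End BilinearForm.

Lemma cvg_minr_cst {R : realFieldType} {T : Type} {G : set_system T}
    {FG : Filter G} (f : T -> R) (l c : R) :
  f k @[k --> G] --> l -> Num.min (f k) c @[k --> G] --> Num.min l c.
Proof.
move=> fl; under eq_fun do rewrite minr_absE; rewrite minr_absE.
apply: cvgM; [|exact: cvg_cst]; apply: cvgD.
  by apply: cvgD => //; exact: cvg_cst.
by apply: cvgN; apply: cvg_norm; apply: cvgB => //; exact: cvg_cst.
Qed.

Lemma cvg_maxr_cst {R : realFieldType} {T : Type} {G : set_system T}
    {FG : Filter G} (f : T -> R) (l c : R) :
  f k @[k --> G] --> l -> Num.max (f k) c @[k --> G] --> Num.max l c.
Proof.
move=> fl; under eq_fun do rewrite maxr_absE; rewrite maxr_absE.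
apply: cvgM; [|exact: cvg_cst]; apply: cvgD.
  by apply: cvgD => //; exact: cvg_cst.
by apply: cvg_norm; apply: cvgB => //; exact: cvg_cst.
Qed.

Lemma L2dot_dominated_cvg0 {R : realType} {E : pmetricType R}
    (m : {measure set (borel E) -> \bar R}) (w : nat -> E -> R) (h : E -> R) :
  (forall k, measurable_fun [set: borel E] (w k)) -> L2 m h ->
  {ae m, forall x, w k x @[k --> \oo] --> 0} ->
  {ae m, forall x k, `|w k x| <= h x} ->
  L2dot m (w k) (w k) @[k --> \oo] --> 0.
Proof.
move=> mw lh w0 wh.
have [] := @dominated_convergence _ (borel E) R m [set: E] measurableT
  (fun k => EFin \o (fun x => w k x * w k x)) (cst 0%E)
  (EFin \o (fun x => h x * h x)).
- by move=> k; apply/measurable_EFinP; exact: measurable_funM.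
- exact: measurable_cst.
- apply: ae_imp w0 => x wx0 _ /=.
  have : w k x * w k x @[k --> \oo] --> (0 : R) * 0 by exact: cvgM.
  by rewrite mulr0 => H; apply/fine_cvgP; split; [exact: nearW|exact: H].
- exact: L2_mul_integrable.
- apply: ae_imp wh => x wx k _ /=.
  by rewrite lee_fin normrM ler_pM.
- move=> _ _; rewrite integral0 => H.
  by apply: (fine_cvg H).
Qed.

(** Since [c ^+ 2 <= k * b <= k * c], a positive [c] cancels. This absorbs the second energy factor
    that the sector condition produces. *)
Lemma le_of_sqr_le_mul {R : realFieldType} (b c k : R) :
  0 <= b -> b <= c -> 0 <= k -> c ^+ 2 <= k * b -> c <= k.
Proof.
move=> b0 bc k0 ck; have [c0|c0] := leP c 0; first exact: le_trans c0 k0.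
rewrite -(ler_pM2r c0) -expr2 (le_trans ck)//; exact: ler_wpM2l.
Qed.

Section PositiveForm.
Context {R : realType} {E : pmetricType R}.
Variable m : {measure set (borel E) -> \bar R}.
Variables (D : set (E -> R)) (B : (E -> R) -> (E -> R) -> R) (K : R).
Hypothesis HB : bilinear_form m D B.
Hypothesis B_ge0 : forall u, D u -> 0 <= B u u.
Hypothesis K_ge0 : 0 <= K.
Hypothesis sector : forall u v, D u -> D v -> B u v ^+ 2 <= K * B u u * B v v.
Hypothesis DL2 : D `<=` L2 m.
Hypothesis contraction : forall u, D u ->
  let u0 := fun x => Num.min (u x) 0 in D u0 /\ B u0 u0 <= B u0 u.
Implicit Types u v w z : E -> R.

Lemma form_min0 u : D u ->
  D (fun x => Num.min (u x) 0) /\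
  B (fun x => Num.min (u x) 0) (fun x => Num.min (u x) 0) <= K * B u u.
Proof.
move=> Du; have [D0 B0] := contraction Du; split => //.
apply: (le_trans B0); apply: (le_of_sqr_le_mul (B_ge0 D0) B0).
  by rewrite mulr_ge0// B_ge0.
by rewrite mulrAC; exact: sector.
Qed.

Lemma form_max0 u : D u ->
  D (fun x => Num.max (u x) 0) /\
  B (fun x => Num.max (u x) 0) (fun x => Num.max (u x) 0)
    <= (2 + 2 * K) * B u u.
Proof.
move=> Du; have [D0 B0] := form_min0 Du.
have -> : (fun x => Num.max (u x) 0) = u \- (fun x => Num.min (u x) 0).
  by apply/funext => x /=; rewrite /Num.min/Num.max; case: ifP; rewrite ?subrr ?subr0.
split; first exact: (form_domB HB).
by apply: (le_trans (form_sqr_sub HB B_ge0 Du D0)); lra.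
Qed.

(** The truncation is [min (u1 - rho, 0) + rho] with [u1] the positive part of [u]. The factor
    [2 + 2 * K] is the cost of [u1], [K] that of the cut at 0, and the other factors 2 come from
    sums and differences. *)
Definition truncation_bound (b r : R) : R :=
  2 * (K * (2 * ((2 + 2 * K) * b) + 2 * r)) + 2 * r.

Lemma form_truncation u rho : D u -> D rho ->
  D (fun x => Num.min (Num.max (u x) 0) (rho x)) /\
  B (fun x => Num.min (Num.max (u x) 0) (rho x))
    (fun x => Num.min (Num.max (u x) 0) (rho x))
    <= truncation_bound (B u u) (B rho rho).
Proof.
move=> Du Drho; have [D1 B1] := form_max0 Du.
set u1 := (fun x => Num.max (u x) 0) in D1 B1.
have D2 := form_domB HB D1 Drho.
have [D3 B3] := form_min0 D2.
have -> : (fun x => Num.min (Num.max (u x) 0) (rho x)) =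
    (fun x => Num.min ((u1 \- rho) x) 0) \+ rho.
  apply/funext => x /=; rewrite -/(u1 x) addr_minl subrK add0r //.
split; first exact: (form_domD HB).
apply: (le_trans (form_sqr_add HB B_ge0 D3 Drho)).
have B2 := form_sqr_sub HB B_ge0 D1 Drho.
rewrite /truncation_bound lerD2r ler_pM2l// (le_trans B3)// ler_wpM2l//.
by apply: (le_trans B2); rewrite lerD2r ler_pM2l.
Qed.

Lemma resolvent_residual (a : R) z g : 0 < a -> D z -> D g ->
  (forall w, D w -> B g w + a * L2dot m g w = L2dot m z w) ->
  a * L2dot m (z \- (fun x => a * g x)) (z \- (fun x => a * g x)) <= K * B z z.
Proof.
move=> a0 Dz Dg Hg; set ag := fun x => a * g x; set r := z \- ag.
have Dag : D ag by exact: (form_domZ HB).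
have Dr : D r by exact: (form_domB HB).
have Br w : D w -> B ag w = a * L2dot m r w.
  move=> Dw; rewrite (formZl HB)// L2dotBl ?L2dotZl//; [|exact: DL2..].
  by rewrite -(Hg _ Dw); rewrite addrK.
(* Testing with the residual [r] itself expresses its norm as a difference. Positivity of that norm
   gives [B ag ag <= B ag z], which allows [B ag ag] to be absorbed after the sector condition. *)
have E1 : a * L2dot m r r = B ag z - B ag ag.
  rewrite -Br// /r (formBr HB) //.
have r0 : 0 <= a * L2dot m r r by rewrite mulr_ge0 ?(ltW a0)// L2dot_ge0.
have c0 : B ag ag <= B ag z by rewrite -subr_ge0 -E1.
have b0 := B_ge0 Dag.
rewrite E1; apply: (@le_trans _ _ (B ag z)); first by rewrite gerBl.
apply: (le_of_sqr_le_mul b0 c0); first by rewrite mulr_ge0// B_ge0.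
by rewrite mulrAC; exact: sector.
Qed.

Lemma resolvent_contraction (a : R) f f' g g' : 0 < a ->
  L2 m f -> L2 m f' -> D g -> D g' ->
  (forall w, D w -> B g w + a * L2dot m g w = L2dot m f w) ->
  (forall w, D w -> B g' w + a * L2dot m g' w = L2dot m f' w) ->
  a ^+ 2 * L2dot m (g \- g') (g \- g') <= L2dot m (f \- f') (f \- f').
Proof.
move=> a0 lf lf' Dg Dg' Hg Hg'.
have Dd := form_domB HB Dg Dg'; set d := g \- g' in Dd *.
have lF := L2B lf lf'; set F := f \- f' in lF *.
have ld := DL2 Dd.
have H : a * L2dot m d d <= L2dot m F d.
  rewrite {1}/d {1}/F !L2dotBl//; [|exact: DL2..].
  rewrite -(Hg _ Dd) -(Hg' _ Dd).
  have := B_ge0 Dd; rewrite {1}/d (formBl HB)//; lra.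
have lad := L2Z a ld.
set ad := fun x => a * d x in lad.
(* Expanding the square of [F \- ad] replaces the Cauchy-Schwarz inequality for [L2dot m F d]. *)
have lB := L2B lF lad; have := L2dot_ge0 m (F \- ad).
have EF : L2dot m F ad = a * L2dot m F d by rewrite L2dotC L2dotZl// (L2dotC _ d).
have Ed : L2dot m ad ad = a * (a * L2dot m d d).
  by rewrite /ad L2dotZl// L2dotC L2dotZl.
rewrite (L2dotBl lF lad lB) !(L2dotC _ _ (F \- ad)) !(L2dotBl lF lad)//.
rewrite (L2dotC _ ad F) EF Ed.
have : a * (a * L2dot m d d) <= a * L2dot m F d by rewrite ler_pM2l.
rewrite expr2 -mulrA; lra.
Qed.

(** [resolvent_residual] needs an element of the domain, while [v] is only square integrable. The
    residual of [v] is split into [v \- z], the residual of [z], and [a] times the difference of the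
    resolvents. By contraction the last is at most as large as the first, so nothing is lost as [a]
    grows. *)
Lemma resolvent_residual_approx (a C e : R) v g :
  0 < a -> L2 m v -> D g ->
  (forall w, D w -> B g w + a * L2dot m g w = L2dot m v w) ->
  (forall f, L2 m f -> exists2 g', D g' &
    forall w, D w -> B g' w + a * L2dot m g' w = L2dot m f w) ->
  (forall d, 0 < d -> exists z, [/\ D z, B z z <= C &
     L2dot m (v \- z) (v \- z) < d]) ->
  0 < e ->
  L2dot m (v \- (fun x => a * g x)) (v \- (fun x => a * g x))
    <= 4 * (K * C / a) + e.
Proof.
move=> a0 lv Dg Hg res app e0.
(* The squared norms of [p], [q], [s] enter with factors 2, 4, 4, and that of [s] is at most that of
   [p]; hence an error [6 * (e / 8) <= e]. *)
have [|z [Dz Bz vz]] := app (e / 8); first by rewrite divr_gt0.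
have lz := DL2 Dz; have lg := DL2 Dg.
have [g' Dg' Hg'] := res _ lz; have lg' := DL2 Dg'.
set p := v \- z in vz; set q := z \- (fun x => a * g' x).
set s := fun x => a * (g' \- g) x.
have lp : L2 m p by exact: L2B.
have lag' := L2Z a lg'.
have lq : L2 m q by exact: L2B.
have ls : L2 m s by apply: L2Z; exact: L2B.
have -> : v \- (fun x => a * g x) = p \+ (q \+ s).
  by apply/funext => x /=; rewrite /p/q/s/=; ring.
have H1 := L2dot_sqr_add lp (L2D lq ls).
have H2 := L2dot_sqr_add lq ls.
have Hq : L2dot m q q <= K * C / a.
  rewrite ler_pdivlMr// mulrC (le_trans (resolvent_residual a0 Dz Dg' Hg'))//.
  by rewrite ler_wpM2l.
have Hs : L2dot m s s <= L2dot m p p.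
  have := resolvent_contraction a0 lv lz Dg Dg' Hg Hg'.
  rewrite -/p; apply: le_trans.
  have lgg := L2B lg' lg; have lgg' := L2B lg lg'.
  rewrite /s L2dotZl// L2dotC L2dotZl// mulrA -expr2 le_eqVlt.
  apply/orP; left; apply/eqP; congr (_ * _); apply: eq_Rintegral => x _ /=; ring.
lra.
Qed.

End PositiveForm.

(** * Energy bounds for truncations of elements of the extended space *)

Section ExtendedForm.
Context {R : realType} {E : pmetricType R}.
Variable m : {measure set (borel E) -> \bar R}.
Variables (D : set (E -> R)) (B Be : (E -> R) -> (E -> R) -> R) (a0 K : R).
Hypothesis Hform : semi_dirichlet_form m D B a0.
Hypothesis Hpos : positive_form m D B.
Hypothesis Hext : extended_form m D B Be.

Lemma positive_form_ge0 u : D u -> 0 <= B u u.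
Proof. by move=> Du; have := Hpos Du (lexx 0); rewrite /form_shift mul0r addr0. Qed.

Lemma sub_extended_space : D `<=` extended_space m D B.
Proof.
move=> u Du; split; first exact: (bf_measurable (sdf_bilinear Hform)).
exists (fun=> u); split => //; last by apply: aeW => x; exact: cvg_cst.
move=> e e_gt0; exists 0%N => i j _ _.
rewrite (formBl (sdf_bilinear Hform))// ?subrr//.
by apply: (form_domB (sdf_bilinear Hform)).
Qed.

Lemma positive_form_sector : exists2 K : R, 0 <= K &
  forall u v, D u -> D v -> B u v ^+ 2 <= K * B u u * B v v.
Proof.
have [k Hk] := ef_bounded Hext; exists (k ^+ 2); first exact: sqr_ge0.
move=> u v Du Dv.
have := Hk _ _ (sub_extended_space Du) (sub_extended_space Dv).
rewrite !(ef_extends Hext)// => H.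
rewrite -[_ ^+ 2]real_normK ?num_real//.
have -> : k ^+ 2 * B u u * B v v = (k * Num.sqrt (B u u) * Num.sqrt (B v v)) ^+ 2.
  by rewrite !exprMn !sqr_sqrtr// positive_form_ge0.
by rewrite lerXn2r// nnegrE (le_trans _ H).
Qed.

Lemma extended_form_ge0 u : extended_space m D B u -> 0 <= Be u u.
Proof.
move=> /(hilbert_ge0 (ef_hilbert Hext)); rewrite /sym_form; lra.
Qed.

(** The element [z] truncates a member of a sequence approximating [u]. Its energy is bounded by
    [form_truncation], and a.e. convergence becomes L2 convergence by domination by [rho]. *)
Lemma truncation_approx (C e : R) u rho :
  0 <= K -> (forall u v, D u -> D v -> B u v ^+ 2 <= K * B u u * B v v) ->
  extended_space m D B u -> (forall x, 0 <= u x) -> Be u u <= C ->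
  D rho -> (forall x, 0 <= rho x) -> 0 < e ->
  let v := fun x => Num.min (u x) (rho x) in
  exists z, [/\ D z, B z z <= truncation_bound K (2 + 2 * C) (B rho rho) &
    L2dot m (v \- z) (v \- z) < e].
Proof.
move=> K0 sec eu u0 uC Drho rho0 e0 v.
have HB := sdf_bilinear Hform.
have contr f : D f -> let f0 := fun x => Num.min (f x) 0 in D f0 /\ B f0 f0 <= B f0 f.
  by move=> Df; apply: (sdf_contraction Hform Df (lexx 0)).
have [_ [w app]] := eu; have [Dw _ wu] := app.
have cvgw := ef_approx Hext eu app.
(* The positive part places [z k], like [v], between 0 and [rho], so that they differ by at most
   [rho]. *)
pose z k := fun x => Num.min (Num.max (w k x) 0) (rho x).
have Dz k : D (z k) /\ B (z k) (z k) <= truncation_bound K (B (w k) (w k)) (B rho rho).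
  exact: (form_truncation HB positive_form_ge0 K0 sec contr).
have mu : measurable_fun [set: borel E] u by case: eu.
have mv : measurable_fun [set: borel E] v.
  by apply: measurable_minr => //; exact: (bf_measurable HB).
have cvgz : L2dot m (v \- z k) (v \- z k) @[k --> \oo] --> 0.
  apply: (@L2dot_dominated_cvg0 _ _ m (fun k => v \- z k) rho).
  - move=> k; apply: measurable_funB => //.
    exact: (bf_measurable HB (Dz k).1).
  - exact: (sdf_sub_L2 Hform).
  - apply: ae_imp wu => x wx.
    have <- : v x - Num.min (Num.max (u x) 0) (rho x) = 0.
      by rewrite /v max_l// subrr.
    apply: cvgB; first exact: cvg_cst.
    by apply: cvg_minr_cst; exact: cvg_maxr_cst.
  - apply: aeW => x k /=; rewrite /v /z.
    have ? : 0 <= Num.min (u x) (rho x) <= rho x.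
      by rewrite le_min u0 rho0 ge_min lexx orbT.
    have ? : 0 <= Num.min (Num.max (w k x) 0) (rho x) <= rho x.
      by rewrite le_min rho0 le_max lexx orbT ge_min lexx orbT.
    rewrite ler_norml; lra.
(* The tolerance 1 gives [B (w k) (w k) <= 2 * 1 + 2 * C], the energy entered in
   [truncation_bound]. *)
have /cvgrPdist_lt/(_ 1 ltr01) [N1 _ HN1] := cvgw.
have /cvgrPdist_lt/(_ e e0) [N2 _ HN2] := cvgz.
pose k := maxn N1 N2.
have kN1 := HN1 k (leq_maxl _ _); have kN2 := HN2 k (leq_maxr _ _).
exists (z k); split; first exact: (Dz k).1.
- apply: (le_trans (Dz k).2); rewrite /truncation_bound.
  rewrite lerD2r ler_pM2l// ler_wpM2l// lerD2r ler_pM2l// ler_wpM2l//.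
    by rewrite addr_ge0// mulr_ge0.
  have ew := sub_extended_space (Dw k).
  have HE := ef_bilinear Hext.
  have ewu := form_domB HE ew eu.
  have := form_sqr_add HE extended_form_ge0 ewu eu.
  rewrite (_ : (w k \- u) \+ u = w k); last by apply/funext => x /=; rewrite subrK.
  rewrite (ef_extends Hext)// => Hw.
  have := kN1; rewrite sub0r normrN => /(le_lt_trans (ler_norm _)) /= Hwu.
  by lra.
- by move: kN2; rewrite sub0r normrN => /(le_lt_trans (ler_norm _)).
Qed.

End ExtendedForm.

(** * Joint measurability of the process *)

Section RightContinuous.
Context {R : realType} {d : measure_display} {S : measurableType d}.

Lemma measurable_fun_countable_index (kappa : R -> nat) (g : nat -> S -> R) :
  (forall k, measurable (kappa @^-1` [set k])) ->
  (forall k, measurable_fun [set: S] (g k)) ->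
  measurable_fun [set: R * S] (fun p => g (kappa p.1) p.2).
Proof.
move=> mk mg _ A mA; rewrite setTI.
rewrite (_ : _ @^-1` A =
    \bigcup_k ((kappa @^-1` [set k]) `*` (g k @^-1` A))).
  apply: bigcupT_measurable => k; apply: measurableX; first exact: mk.
  by rewrite -[X in measurable X]setTI; exact: mg.
apply/seteqP; split => [[t s] /= gA|[t s] [k _ [/= -> //]]].
by exists (kappa t).
Qed.

(* [phi] is approximated by its values at the grid points of mesh [1/n] lying
   strictly to the right.  Nothing is assumed of [phi] at negative times, hence
   [Num.max]. *)
Lemma measurable_fun_right_continuous (phi : R -> S -> R) :
  (forall t, 0 <= t -> measurable_fun [set: S] (phi t)) ->
  (forall t s, 0 <= t -> phi u s @[u --> t^'+] --> phi t s) ->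
  measurable_fun [set: R * S] (fun p => phi (Num.max p.1 0) p.2).
Proof.
move=> mphi rphi.
pose pos (t : R) := Num.max t 0.
have pos0 t : 0 <= pos t by rewrite /pos le_max lexx orbT.
pose kappa n (t : R) := Num.truncn (n.+1%:R * pos t).
have kappaP n t : (kappa n t)%:R <= n.+1%:R * pos t < (kappa n t).+1%:R.
  by apply: truncn_itv; rewrite mulr_ge0.
pose grid n t := (kappa n t).+1%:R / n.+1%:R : R.
have gridP n t : pos t < grid n t <= pos t + n.+1%:R^-1.
  have /andP[k1 k2] := kappaP n t.
  rewrite /grid ltr_pdivlMr// mulrC k2/= ler_pdivrMr// mulrDl mulVf//.
  by rewrite -natr1 mulrC lerD2r.
apply: (@measurable_fun_cvg _ _ _ _ (fun n p => phi (grid n p.1) p.2)).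
  move=> n.
  apply: (@measurable_fun_countable_index (kappa n)
    (fun k => phi (k.+1%:R / n.+1%:R))); last by move=> k; exact: mphi.
  move=> k.
  have mg : measurable_fun [set: R] (fun t => n.+1%:R * pos t).
    by apply: measurable_funM => //; exact: measurable_maxr.
  rewrite (_ : _ @^-1` _ = (fun t => n.+1%:R * pos t) @^-1` `[k%:R, k.+1%:R[).
    by rewrite -[X in measurable X]setTI; apply: mg.
  apply/seteqP; split => t /=; rewrite in_itv/=.
    by move=> <-; exact: kappaP.
  exact: truncn_def.
move=> [t s] _ /=.
have := rphi _ s (pos0 t); move/cvg_at_rightP/(_ (grid^~ t)); apply; split.
  by move=> n; have /andP[] := gridP n t.
apply: (@squeeze_cvgr _ _ _ _ (fun=> pos t) (fun n => pos t + n.+1%:R^-1)).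
- by apply: nearW => n; have /andP[/ltW -> ->] := gridP n t.
- exact: cvg_cst.
- rewrite -[X in _ --> X]addr0; apply: cvgD; first exact: cvg_cst.
  exact: cvg_harmonic.
Qed.

End RightContinuous.

(** * Borel sets of the state space with its cemetery *)

Definition ext0r {R : realType} {E : Type} (f : E -> R)
    (z : one_point_compactification E) : R :=
  if z is Some x then f x else 0.

Lemma ext0_EFin {R : realType} {E : pmetricType R} (f : E -> R) (z : cemetery_ext E) :
  ext0 (EFin \o f) z = (ext0r f z)%:E.
Proof. by case: z. Qed.

Section Cemetery.
Context {R : realType} {E : pmetricType R}.
Local Notation Ed := (cemetery_ext E).

Lemma borel_open (T : ptopologicalType) (U : set T) :
  open U -> measurable (U : set (borel T)).
Proof. by move=> oU; exact: sub_sigma_algebra. Qed.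

Lemma measurable_some : measurable_fun [set: borel E] (Some : borel E -> borel Ed).
Proof.
apply: (@measurability _ _ (borel E) (borel Ed) _ _ (@open Ed)) => //.
move=> _ [U oU <-]; rewrite setTI; apply: borel_open.
by apply: open_comp => // x _; exact: one_point_compactification_some_continuous.
Qed.

(** Open subsets of [E] remain open in the extension and are stable under intersection. A Dynkin
    argument reaches Borel sets, complements being taken inside the open image of [E]. *)
Lemma measurable_image_some (A : set (borel E)) :
  measurable A -> measurable ((Some @` A) : set (borel Ed)).
Proof.
have mT : measurable ((Some @` [set: E]) : set (borel Ed)).
  by apply: borel_open; apply: one_point_compactification_open_some; exact: openT.
move=> mA.
apply: (@dynkin_induction _ (borel E) (@open E)
  (fun A => measurable ((Some @` A) : set (borel Ed)))) => //.
- by move=> U V oU oV; exact: openI.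
- by move=> U oU; apply: borel_open; exact: one_point_compactification_open_some.
- move=> B mB mSB.
  rewrite (_ : Some @` (~` B) = (Some @` [set: E]) `\` (Some @` B)).
    exact: measurableD.
  apply/seteqP; split => [_ [x nBx <-]|_ [[x _ <-] nB]].
    by split; [exists x|case=> y By [] yx; apply: nBx; rewrite -yx].
  by exists x => // Bx; apply: nB; exists x.
- move=> F mF tF mSF; rewrite image_bigcup; exact: bigcupT_measurable.
Qed.

Lemma measurable_cemetery : measurable ([set None] : set (borel Ed)).
Proof.
rewrite (_ : [set None] = ~` (Some @` [set: E])).
  by apply: measurableC; exact: measurable_image_some.
by apply/seteqP; split => [z /= -> [] //|[x|]//= nx]; case: nx; exists x.
Qed.

Lemma measurable_ext0 (f : E -> \bar R) : measurable_fun [set: borel E] f ->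
  measurable_fun [set: borel Ed] (ext0 f).
Proof.
move=> mf _ A mA; rewrite setTI.
have mfA : measurable ((Some @` (f @^-1` A)) : set (borel Ed)).
  by apply: measurable_image_some; rewrite -[X in measurable X]setTI; exact: mf.
have [A0|A0] := pselect (A 0%E).
  rewrite (_ : _ @^-1` A = (Some @` (f @^-1` A)) `|` [set None]).
    by apply: measurableU => //; exact: measurable_cemetery.
  apply/seteqP; split => [[x|]/= Ax|z [[x Ax <-]|->]]//; last by right.
  by left; exists x.
rewrite (_ : _ @^-1` A = (Some @` (f @^-1` A)))//.
by apply/seteqP; split => [[x|]/= Ax|z [x Ax <-]]//; exists x.
Qed.

Lemma measurable_ext0r (f : E -> R) : measurable_fun [set: borel E] f ->
  measurable_fun [set: borel Ed] (ext0r f).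
Proof.
move=> mf; apply/measurable_EFinP.
rewrite (_ : EFin \o ext0r f = ext0 (EFin \o f)).
  by apply: measurable_ext0; exact/measurable_EFinP.
by apply/funext => z /=; rewrite ext0_EFin.
Qed.

Lemma continuous_measurable_fun (f : E -> R) : continuous f ->
  measurable_fun [set: borel E] f.
Proof.
move=> cf; apply: (@measurability _ _ (borel E) _ _ _ (@RGenOInfty.G R)).
  exact: RGenOInfty.measurableE.
move=> _ [_ [x ->] <-]; rewrite setTI; apply: borel_open.
by apply: open_comp => //; exact: interval_open.
Qed.

Lemma ext0r_continuous_some (f : E -> R) (x : E) : continuous f ->
  ext0r f z @[z --> (Some x : Ed)] --> f x.
Proof. by move=> cf A /cf. Qed.

Lemma open_indicator_approx (U : set E) : open U ->
  exists f : nat -> E -> R, [/\ forall n, continuous (f n),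
    forall n x, 0 <= f n x <= 1 &
    forall x, f n x @[n --> \oo] --> (\1_U x : R)].
Proof.
(* If [U] is the whole space, the distance to its complement is infinite and [fine] would send it to
   0. *)
move=> oU; have [UT|/existsNP[c Uc]] := pselect (forall x, U x).
  exists (fun _ _ => 1); split => //.
  - by move=> n x; exact: cvg_cst.
  - by move=> n x; rewrite ler01 lexx.
  - by move=> x; rewrite indicE mem_set//; exact: cvg_cst.
pose g x := fine (edist_inf (~` U) x).
have gfin x : edist_inf (~` U) x \is a fin_num.
  rewrite ge0_fin_numE ?edist_inf_ge0//.
  apply: (@le_lt_trans _ _ (edist (x, c))); first by apply: ereal_inf_lbound; exists c.
  have r0 : 0 < mdist x c + 1 by rewrite ltr_wpDl// mdist_ge0.
  rewrite (le_lt_trans (@edist_fin _ _ (mdist x c + 1) (x, c) _ _)) ?ltry//.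
  by rewrite ballEmdist/= ltrDl.
have g0 x : 0 <= g x by rewrite fine_ge0// edist_inf_ge0.
have cg : continuous g.
  move=> x; apply: fine_cvg; rewrite fineK//; exact: edist_inf_continuous.
exists (fun n x => Num.min (n%:R * g x) 1); split.
- move=> n x; apply: cvg_minr_cst.
  by apply: cvgM; [exact: cvg_cst|exact: cg].
- by move=> n x; rewrite le_min ler01 mulr_ge0//= ge_min lexx orbT.
- move=> x; have [Ux|Ux] := pselect (U x); rewrite indicE; last first.
    rewrite memNset// (_ : (fun n => _) = fun=> 0); first exact: cvg_cst.
    by apply/funext => n; rewrite /g edist_inf0// mulr0 min_l.
  rewrite mem_set//.
  have /nbhs_ballP[e /= e0 eU] : nbhs x U by exact: open_nbhs_nbhs.
  have ge : e <= g x.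
    rewrite -lee_fin fineK//; apply: le_ereal_inf_tmp => _ [y Uy <-].
    by rewrite leNgt; apply/negP => /edist_lt_ball /= /eU.
  apply: cvg_near_cst; near=> n.
  rewrite min_r// -ler_pdivrMr ?(lt_le_trans e0)//.
  rewrite (@le_trans _ _ e^-1)//; last by near: n; exact: nbhs_infty_ger.
  by rewrite div1r lef_pV2// posrE// (lt_le_trans e0).
Unshelve. all: by end_near. Qed.

End Cemetery.

Lemma bounded_cvg_integral {R : realType} {d : measure_display}
    {T : measurableType d} (Q : probability T R) (g : nat -> T -> R) (h : T -> R) :
  (forall n, measurable_fun [set: T] (g n)) ->
  (forall n x, 0 <= g n x <= 1) ->
  (forall x, g n x @[n --> \oo] --> h x) ->
  (\int[Q]_x (g n x)%:E @[n --> \oo] --> \int[Q]_x (h x)%:E)%E.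
Proof.
move=> mg g01 gh.
apply: (@dominated_cvg _ _ _ Q _ measurableT (fun n => EFin \o g n) _
  (EFin \o cst 1)).
- by move=> n; exact/measurable_EFinP.
- by move=> x _; apply/fine_cvgP; split; [exact: nearW|exact: gh].
- by [].
- exact: finite_measure_integrable_cst.
- move=> n x _ /=; rewrite lee_fin ger0_norm; by case/andP: (g01 n x).
Qed.

(** * Measurability of kernels from their values on continuous functions *)

Section ProbabilityKernel.
Context {R : realType} {E : pmetricType R}.
Context {d : measure_display} {T : measurableType d}.
Local Notation Ed := (cemetery_ext E).
Variable nu : T -> probability (borel Ed) R.
Hypothesis mnu : forall f : E -> R, continuous f -> (forall x, 0 <= f x <= 1) ->
  measurable_fun [set: T] (fun p => \int[nu p]_z (ext0r f z)%:E)%E.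

(** Open sets are reached by bounded convergence, Borel sets by a Dynkin argument. The result serves
    twice: for Dirac masses at the position of the path and for the laws of the process. *)
Lemma measurable_fun_kernel_some (A : set (borel E)) : measurable A ->
  measurable_fun [set: T] (fun p => nu p (Some @` A)).
Proof.
have Hopen U : open U -> measurable_fun [set: T] (fun p => nu p (Some @` U)).
  move=> oU; have [f [cf f01 fU]] := open_indicator_approx oU.
  have mU := measurable_image_some (borel_open oU).
  apply: (@emeasurable_fun_cvg _ _ _ _
    (fun n p => \int[nu p]_z (ext0r (f n) z)%:E)%E).
    by move=> n; apply: mnu.
  move=> p _.
  rewrite -[X in _ --> X](_ : \int[nu p]_z (\1_(Some @` U) z)%:E = _)%E; last first.
    by rewrite integral_indic// setIT.
  apply: bounded_cvg_integral.
  - by move=> n; apply: measurable_ext0r; exact: continuous_measurable_fun.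
  - by move=> n [x|] /=; [exact: f01|rewrite lexx ler01].
  - move=> [x|] /=; last first.
      by rewrite indicE memNset; [exact: cvg_cst|case].
    rewrite (_ : \1_(Some @` U) (Some x : Ed) = \1_U x); first exact: fU.
    rewrite !indicE; congr (_%:R); congr nat_of_bool.
    by apply/idP/idP; rewrite !inE; [case=> y Uy [<-]|exists x].
move=> mA.
apply: (@dynkin_induction _ (borel E) (@open E)
  (fun A => measurable_fun [set: T] (fun p => nu p (Some @` A)))) => //.
- by move=> U V oU oV; exact: openI.
- by apply: Hopen; exact: openT.
- move=> B mB HB.
  apply: (eq_measurable_fun (fun p => nu p (Some @` [set: E]) - nu p (Some @` B))%E).
    move=> p _.
    have mT : measurable ((Some @` [set: E]) : set (borel Ed)).
      exact: measurable_image_some.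
    have mSB := measurable_image_some mB.
    rewrite [in RHS](_ : Some @` (~` B) = (Some @` [set: E]) `\` (Some @` B)).
      rewrite measureD//; last by rewrite (le_lt_trans (probability_le1 _ _))// ltry.
      by rewrite setIidr//; exact: image_subset.
    apply/seteqP; split => [_ [x nBx <-]|_ [[x _ <-] nB]].
      by split; [exists x|case=> y By [] yx; apply: nBx; rewrite -yx].
    by exists x => // Bx; apply: nB; exists x.
  by apply: emeasurable_funB => //; apply: Hopen; exact: openT.
- move=> G mG tG HG.
  apply: (eq_measurable_fun (fun p => \sum_(0 <= k <oo) nu p (Some @` (G k)))%E).
    move=> p _; rewrite image_bigcup measure_semi_bigcup//.
    + by move=> k; exact: measurable_image_some.
    + apply/trivIsetP => i j _ _ ij.
      move/trivIsetP : tG => /(_ i j Logic.I Logic.I ij) GG.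
      apply/seteqP; split => // z [[x Gx <-] [y Gy [yx]]].
      suff : (G i `&` G j) x by rewrite GG.
      by split; [exact: Gx|rewrite -yx].
    + by apply: bigcupT_measurable => k; exact: measurable_image_some.
  by apply: ge0_emeasurable_sum.
Qed.

Lemma measurable_fun_kernel_ext (U : set (borel Ed)) : measurable U ->
  measurable_fun [set: T] (fun p => nu p U).
Proof.
move=> mU.
have mSU : measurable ((Some @^-1` U) : set (borel E)).
  by rewrite -[X in measurable X]setTI; exact: measurable_some.
(* If [U] contains [None], its complement is an image under [Some], and the total mass 1 recovers
   [U]. *)
have [UN|UN] := pselect (U None); last first.
  rewrite (_ : U = Some @` (Some @^-1` U)); first exact: measurable_fun_kernel_some.
  by apply/seteqP; split => [[x|]//= Ux|_ [x Ux <-]//]; exists x.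
have mCU : measurable ((Some @^-1` (~` U)) : set (borel E)).
  by rewrite preimage_setC; exact: measurableC.
apply: (eq_measurable_fun (fun p => 1 - nu p (Some @` (Some @^-1` (~` U))))%E).
  move=> p _.
  rewrite (_ : Some @` (Some @^-1` (~` U)) = ~` U); last first.
    by apply/seteqP; split => [_ [x Ux <-]//|[x|]//= Ux]; exists x.
  by rewrite probability_setC// oppeB// addeA subee// add0e.
by apply: emeasurable_funB => //; exact: measurable_fun_kernel_some.
Qed.

Lemma measurable_fun_integral_ext (g : Ed -> \bar R) :
  (forall z, 0 <= g z)%E -> measurable_fun [set: borel Ed] g ->
  measurable_fun [set: T] (fun p => \int[nu p]_z g z)%E.
Proof.
move=> g0 mg; exact: (measurable_fun_integral_kernel measurable_fun_kernel_ext).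
Qed.

End ProbabilityKernel.

(** * Joint measurability in time and path, and in time and starting point *)

Section Process.
Context {R : realType} {E : pmetricType R}.
Context {d : measure_display} {Omega : measurableType d}.
Local Notation Ed := (cemetery_ext E).
Variables (X : R -> Omega -> Ed) (P : Ed -> probability Omega R).
Variable F : R -> set (set Omega).
Hypothesis Hhunt : hunt_process X P F.

Lemma measurable_process t : 0 <= t ->
  measurable_fun [set: Omega] (X t : Omega -> borel Ed).
Proof.
move=> t0 _ A mA; rewrite setTI.
exact: ((hp_filtration Hhunt t0).2 _ (hp_adapted Hhunt t0 mA)).
Qed.

Let pos (t : R) := Num.max t 0.

Let pos_ge0 t : 0 <= pos t. Proof. by rewrite /pos le_max lexx orbT. Qed.

(** [ext0r f] may be discontinuous at the cemetery, as [f] need not vanish at infinity; but a path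
    that has reached the cemetery stays there. *)
Lemma ext0r_process_right_continuous (f : E -> R) t w : continuous f -> 0 <= t ->
  ext0r f (X u w) @[u --> t^'+] --> ext0r f (X t w).
Proof.
move=> cf t0; have := @hp_right_continuous _ _ _ _ _ _ _ Hhunt t w t0.
case Xt : (X t w) => [x|] cX.
  exact: (cvg_comp (X ^~ w) (ext0r f) cX (@ext0r_continuous_some R E f x cf)).
apply: cvg_near_cst; near=> u.
by rewrite (hp_cemetery Hhunt t0 _ Xt)//; apply: ltW; near: u; exact: nbhs_right_gt.
Unshelve. all: by end_near. Qed.

Lemma measurable_fun_process (g : Ed -> \bar R) :
  (forall z, 0 <= g z)%E -> measurable_fun [set: borel Ed] g ->
  measurable_fun [set: R * Omega] (fun p => g (X (pos p.1) p.2)).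
Proof.
move=> g0 mg.
(* Evaluation along the path is integration against a Dirac mass, which reduces the claim to
   continuous functions, where right-continuity in time applies. *)
pose nu (p : R * Omega) : probability (borel Ed) R := \d_(X (pos p.1) p.2 : borel Ed).
apply: (eq_measurable_fun (fun p => \int[nu p]_z g z)%E).
  by move=> p _; rewrite integral_dirac// diracT mul1e.
apply: measurable_fun_integral_ext => // f cf f01.
have mf := measurable_ext0r (continuous_measurable_fun cf).
apply: (eq_measurable_fun (fun p => (ext0r f (X (pos p.1) p.2))%:E)).
  by move=> p _; rewrite integral_dirac ?diracT ?mul1e//; exact/measurable_EFinP.
apply/measurable_EFinP.
apply: (@measurable_fun_right_continuous _ _ _ (fun t w => ext0r f (X t w))).
  by move=> t t0; exact: (measurableT_comp mf (measurable_process t0)).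
by move=> t w t0; exact: ext0r_process_right_continuous.
Qed.

Let Xpos t : {mfun Omega >-> borel Ed} :=
  mfun_Sub (mem_set (measurable_process (pos_ge0 t))).

Lemma measurable_fun_expectation_process t (g : Ed -> \bar R) : 0 <= t ->
  (forall z, 0 <= g z)%E -> measurable_fun [set: borel Ed] g ->
  measurable_fun [set: borel E] (fun x => \int[P (Some x)]_w g (X t w))%E.
Proof.
move=> t0 g0 mg.
have pt : pos t = t by rewrite /pos max_l.
apply: (@eq_measurable_fun _ _ (borel E) _ _
  (fun x => \int[distribution (P (Some x)) (Xpos t)]_z g z)%E).
  by move=> x _; rewrite ge0_integral_distribution// /= pt.
apply: measurable_fun_integral_kernel => // U mU.
rewrite /distribution /pushforward /=.
have := hp_kernel Hhunt (pos_ge0 t) mU.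
move=> /measurableT_comp; apply; exact: measurable_some.
Qed.

Lemma measurable_fun_transition_joint (g : Ed -> \bar R) :
  (forall z, 0 <= g z)%E -> measurable_fun [set: borel Ed] g ->
  measurable_fun [set: R * borel E]
    (fun p => \int[P (Some p.2)]_w g (X (pos p.1) w))%E.
Proof.
move=> g0 mg.
pose nu (p : R * borel E) : probability (borel Ed) R :=
  distribution (P (Some p.2)) (Xpos p.1).
apply: (eq_measurable_fun (fun p => \int[nu p]_z g z)%E).
  by move=> p _; rewrite ge0_integral_distribution.
apply: measurable_fun_integral_ext => // f cf f01.
have mf := measurable_ext0r (continuous_measurable_fun cf).
have f01' z : 0 <= ext0r f z <= 1 by case: z => [x|] /=; rewrite ?lexx ?ler01.
have fin x t : 0 <= t ->
    (\int[P (Some x)]_w (ext0r f (X t w))%:E)%E \is a fin_num.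
  move=> t0; rewrite ge0_fin_numE; last first.
    by apply: integral_ge0 => w _; rewrite lee_fin; have /andP[] := f01' (X t w).
  apply: (@le_lt_trans _ _ (\int[P (Some x)]_w 1)%E).
    apply: ge0_le_integral => //.
    - by move=> w _; rewrite lee_fin; have /andP[] := f01' (X t w).
    - by apply/measurable_EFinP; exact: (measurableT_comp mf (measurable_process t0)).
    - by move=> w _; rewrite lee_fin; have /andP[] := f01' (X t w).
  by rewrite integral_cst// mul1e (le_lt_trans (probability_le1 _ _))// ltry.
apply: (@eq_measurable_fun _ _ (R * borel E)%type _ _
    (fun p => (fine (\int[P (Some p.2)]_w (ext0r f (X (pos p.1) w))%:E))%:E)%E).
  move=> p _; rewrite fineK ?fin// ge0_integral_distribution//.
    exact/measurable_EFinP.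
  by move=> z; rewrite lee_fin; have /andP[] := f01' z.
apply/measurable_EFinP.
apply: (@measurable_fun_right_continuous _ _ (borel E)
  (fun t x => fine (\int[P (Some x)]_w (ext0r f (X t w))%:E))).
  move=> t t0; apply: measurableT_comp; first exact: fine_measurable.
  apply: (@measurable_fun_expectation_process t (EFin \o ext0r f)) => //.
    by move=> z; rewrite lee_fin; have /andP[] := f01' z.
  exact/measurable_EFinP.
(* Testing right limits on sequences lets right-continuity pass from paths to expectations by
   bounded convergence. *)
move=> t x t0; apply/cvg_at_rightP => v [vt vcvg].
have v0 n : 0 <= v n by rewrite (le_trans t0)// ltW.
apply: fine_cvg; rewrite fineK ?fin//.
apply: bounded_cvg_integral => //.
- by move=> n; exact: (measurableT_comp mf (measurable_process (v0 n))).
- move=> w; have := @ext0r_process_right_continuous f t w cf t0.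
  by move/cvg_at_rightP; apply; split.
Qed.

End Process.

(** * Resolvents of the process and of the form *)

Section Resolvent.
Context {R : realType} {E : pmetricType R}.
Context {d : measure_display} {Omega : measurableType d}.
Local Notation Ed := (cemetery_ext E).
Variables (X : R -> Omega -> Ed) (P : Ed -> probability Omega R).
Variable F : R -> set (set Omega).
Hypothesis Hhunt : hunt_process X P F.

Let pos (t : R) := Num.max t 0.

Let pos_ge0 t : 0 <= pos t. Proof. by rewrite /pos le_max lexx orbT. Qed.

(** The indicator belongs to the weight so that time integrals run over the whole line, where the
    joint measurability results hold with the clipped time [pos t]. *)
Definition discount (a t : R) : R := expR (- a * t) * \1_`[0, +oo[ t.

Lemma discount_ge0 a t : 0 <= discount a t.
Proof. by rewrite mulr_ge0 ?expR_ge0// indicE. Qed.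

Lemma measurable_discount a : measurable_fun [set: R] (discount a).
Proof.
apply: measurable_funM.
  by apply: measurableT_comp => //; exact: measurable_funM.
exact: measurable_indic.
Qed.

Lemma integral_discount (a : R) (g h : R -> \bar R) :
  (forall t, 0 <= t -> g t = h t) ->
  (\int[lebesgue_measure]_(t in `[0%R, +oo[) ((expR (- a * t))%:E * g t) =
   \int[lebesgue_measure]_t ((discount a t)%:E * h t))%E.
Proof.
move=> gh; rewrite integral_mkcond; apply: eq_integral => t _.
rewrite patchE /discount indicE.
have [t0|t0] := boolP (t \in `[0, +oo[%classic).
  by rewrite mulr1 gh//; move: t0; rewrite inE/= in_itv/= andbT.
by rewrite mulr0 mul0e.
Qed.

Lemma lt_integral_discount a (C : \bar R) : 0 < a -> (0 <= C < +oo)%E ->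
  (\int[lebesgue_measure]_t ((discount a t)%:E * C) < +oo)%E.
Proof.
move=> a0 /andP[C0 Cy].
have [c c0 ->] : exists2 c : R, 0 <= c & C = c%:E.
  exists (fine C); first exact: fine_ge0.
  by rewrite fineK// ge0_fin_numE.
under eq_integral => t _.
  (* Up to the factor [c / a] the integrand is the density of the exponential law of parameter [a],
     of integral 1. *)
  rewrite (_ : _ * _ = (c / a)%:E * (exponential_pdf a t)%:E)%E; last first.
    rewrite -!EFinM /exponential_pdf patchE /discount indicE.
    have [t0|t0] := boolP (t \in `[0, +oo[%classic); last by rewrite !(mulr0, mul0r).
    by rewrite mulr1 mulrA divfK ?gt_eqF// mulrC.
  over.
rewrite ge0_integralZl//.
- by rewrite integral_exponential_pdf// mule1 ltry.
- by apply/measurable_EFinP; exact: measurable_exponential_pdf.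
- by move=> t _; rewrite lee_fin; apply: exponential_pdf_ge0; exact: ltW.
- by rewrite lee_fin divr_ge0// ltW.
Qed.

Section Nonneg.
Variable f : E -> \bar R.
Hypothesis mf : measurable_fun [set: borel E] f.
Hypothesis f0 : forall x, (0 <= f x)%E.

Let ext0_ge0 (z : Ed) : (0 <= ext0 f z)%E. Proof. by case: z. Qed.

Lemma transition_ge0 t x : (0 <= transition X P t f x)%E.
Proof. by apply: integral_ge0 => w _. Qed.

Lemma measurable_transition t : 0 <= t ->
  measurable_fun [set: borel E] (transition X P t f).
Proof.
move=> t0.
by apply: (measurable_fun_expectation_process Hhunt) => //; exact: measurable_ext0.
Qed.

Lemma measurable_discount_transition a :
  measurable_fun [set: R * borel E]
    (fun p => (discount a p.1)%:E * transition X P (pos p.1) f p.2)%E.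
Proof.
apply: emeasurable_funM.
  apply/measurable_EFinP; apply: measurableT_comp => //.
  exact: measurable_discount.
by apply: (measurable_fun_transition_joint Hhunt) => //; exact: measurable_ext0.
Qed.

Lemma resolventE a x : resolvent X P a f x =
  (\int[lebesgue_measure]_t ((discount a t)%:E * transition X P (pos t) f x))%E.
Proof.
rewrite /resolvent.
pose g (p : R * Omega) := ((discount a p.1)%:E * ext0 f (X (pos p.1) p.2))%E.
have mg : measurable_fun [set: R * Omega] g.
  apply: emeasurable_funM.
    apply/measurable_EFinP; apply: measurableT_comp => //.
    exact: measurable_discount.
  by apply: (measurable_fun_process Hhunt) => //; exact: measurable_ext0.
have g0 p : (0 <= g p)%E by rewrite mule_ge0// lee_fin discount_ge0.
rewrite (_ : (\int[_]_w _ = \int[P (Some x)]_w \int[lebesgue_measure]_t g (t, w))%E).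
  rewrite -fubini_tonelli//; apply: eq_integral => t _.
  rewrite /g/= ge0_integralZl//.
  - exact: (measurableT_comp (measurable_ext0 mf) (measurable_process Hhunt (pos_ge0 t))).
  - by rewrite lee_fin discount_ge0.
apply: eq_integral => w _; apply: integral_discount => t t0.
by rewrite /pos max_l.
Qed.

Lemma resolvent_ge0 a x : (0 <= resolvent X P a f x)%E.
Proof.
rewrite resolventE; apply: integral_ge0 => t _.
by rewrite mule_ge0 ?transition_ge0// lee_fin discount_ge0.
Qed.

Lemma measurable_resolvent a : measurable_fun [set: borel E] (resolvent X P a f).
Proof.
rewrite (_ : resolvent X P a f = fubini_G lebesgue_measure
   (fun p : R * borel E => (discount a p.1)%:E * transition X P (pos p.1) f p.2)%E).
  apply: measurable_fun_fubini_tonelli_G; first exact: measurable_discount_transition.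
  by move=> p; rewrite mule_ge0 ?transition_ge0// lee_fin discount_ge0.
by apply/funext => x; rewrite resolventE.
Qed.

Lemma integral_resolvent (m : {sigma_finite_measure set (borel E) -> \bar R})
    (A : set (borel E)) a : measurable A ->
  (\int[m]_(x in A) resolvent X P a f x = \int[lebesgue_measure]_t
     ((discount a t)%:E * \int[m]_(x in A) transition X P (pos t) f x))%E.
Proof.
move=> mA; rewrite integral_mkcond.
pose g (p : R * borel E) := ((discount a p.1)%:E * transition X P (pos p.1) f p.2
  * (\1_A p.2)%:E)%E.
have mg : measurable_fun [set: R * borel E] g.
  apply: emeasurable_funM; first exact: measurable_discount_transition.
  apply/measurable_EFinP; apply: measurableT_comp => //.
have g0 p : (0 <= g p)%E.
  by rewrite !mule_ge0 ?transition_ge0// lee_fin ?discount_ge0// indicE.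
rewrite (_ : (\int[_]_x _ = \int[m]_x \int[lebesgue_measure]_t g (t, x))%E).
  rewrite -fubini_tonelli//; apply: eq_integral => t _.
  rewrite /g/= [in RHS]integral_mkcond -ge0_integralZl//.
  - apply: eq_integral => x _; rewrite -muleA; congr (_ * _)%E.
    by rewrite patchE indicE; case: ifP; rewrite ?mule1 ?mule0.
  - apply/(measurable_restrictT _ mA).
    apply: measurable_funTS; exact: measurable_transition.
  - by move=> x _; rewrite patchE; case: ifP => // _; exact: transition_ge0.
  - by rewrite lee_fin discount_ge0.
apply: eq_integral => x _; rewrite patchE /g/= indicE.
case: ifP => [xA|xA]; first by under [in RHS]eq_integral do rewrite mule1; rewrite resolventE.
by under [in RHS]eq_integral do rewrite mule0; rewrite integral0.
Qed.

End Nonneg.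

Section AssociatedResolvent.
Variable m : {sigma_finite_measure set (borel E) -> \bar R}.
Variables (D : set (E -> R)) (B : (E -> R) -> (E -> R) -> R) (a0 : R).
Hypothesis DL2 : D `<=` L2 m.
Hypothesis a0_ge0 : 0 <= a0.
Hypothesis Hassoc : associated X P m D B a0.

Lemma L2_indic (A : set (borel E)) : measurable A -> (m A < +oo)%E ->
  L2 m (\1_A : E -> R).
Proof.
move=> mA Afin; apply: L2_of_integrable_sqr; first exact: measurable_indic.
rewrite (_ : _ \o _ = fun x => (\1_A x)%:E).
  apply/integrableP; split; first exact/measurable_EFinP/measurable_indic.
  under eq_integral do rewrite gee0_abs ?lee_fin ?indicE//.
  by rewrite integral_indic// setIT.
by apply/funext => x /=; rewrite indicE; case: (_ \in _); rewrite ?mulr1 ?mulr0.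
Qed.

Lemma L2_integrable_on f (A : set (borel E)) : measurable A -> (m A < +oo)%E ->
  L2 m f -> m.-integrable A (EFin \o f) /\
  (\int[m]_(x in A) (f x)%:E = (L2dot m f \1_A)%:E)%E.
Proof.
move=> mA Afin lf.
have fA := L2_mul_integrable lf (L2_indic mA Afin).
have E1 : (EFin \o f) \_ A = EFin \o (fun x => f x * \1_A x).
  by apply/funext => x /=; rewrite patchE indicE; case: ifP; rewrite ?mulr1 ?mulr0.
split; first by apply/(integrable_mkcond _ mA); rewrite E1.
by rewrite integral_mkcond E1 /L2dot /Rintegral fineK// integrable_fin_num.
Qed.

(** The two sides are compared after integration over sets [A] of finite measure. Tonelli turns the
    integral of the process resolvent into the Laplace transform of [L2dot m (T t f) \1_A], which is
    [L2dot m G \1_A]. Boundedness of [f] is required by [associated] and keeps these integrals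
    finite. *)
Lemma resolvent_associated (f : E -> R) (a M : R) : a0 < a ->
  L2 m f -> (forall x, 0 <= f x <= M) ->
  exists G, [/\ D G,
    forall v, D v -> B G v + a * L2dot m G v = L2dot m f v &
    {ae m, forall x, resolvent X P a (EFin \o f) x = (G x)%:E}].
Proof.
move=> a0a lf fM.
have [T HT Tassoc] := Hassoc.
have [G [DG HG GT]] := fsg_resolvent HT a0a lf.
exists G; split => //.
have a_gt0 : 0 < a by exact: le_lt_trans a0a.
have mf := L2_measurable lf.
have mEf : measurable_fun [set: borel E] (EFin \o f) by exact/measurable_EFinP.
have Ef0 x : (0 <= (EFin \o f) x)%E by rewrite lee_fin; case/andP: (fM x).
have lG := DL2 DG.
have key (A : set (borel E)) : measurable A -> (m A < +oo)%E ->
    (\int[m]_(x in A) (G x)%:E =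
     \int[m]_(x in A) resolvent X P a (EFin \o f) x)%E.
  move=> mA Afin.
  have lA := L2_indic mA Afin.
  rewrite (L2_integrable_on mA Afin lG).2 (GT _ lA).
  rewrite integral_resolvent//.
  set Z := fun t : R => (\int[m]_(x in A) transition X P (pos t) (EFin \o f) x)%E.
  have ZT t : 0 < t -> Z t = (L2dot m (T t f) \1_A)%:E.
    move=> t0; rewrite -(L2_integrable_on mA Afin (fsg_L2 HT (ltW t0) lf)).2.
    rewrite /Z /pos max_l ?ltW//.
    apply: ae_eq_integral => //.
    - by apply: measurable_funTS; apply: measurable_transition => //; exact: ltW.
    - apply/measurable_EFinP; apply: measurable_funTS.
      exact: (L2_measurable (fsg_L2 HT (ltW t0) lf)).
    - have bf : exists M', forall x, `|f x| <= M'.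
        by exists M => x; have /andP[h1 h2] := fM x; rewrite ger0_norm.
      have ae : {ae m, forall x, A x ->
          transition X P t (EFin \o f) x = (EFin \o T t f) x}.
        by apply: ae_imp (Tassoc t f t0 lf bf) => x /= -> _.
      exact: ae.
  have Z0 t : (0 <= Z t)%E.
    by apply: integral_ge0 => x _; exact: transition_ge0.
  have mZ : measurable_fun [set: R] (fun t => (discount a t)%:E * Z t)%E.
    pose g (p : R * borel E) :=
      ((discount a p.1)%:E * transition X P (pos p.1) (EFin \o f) p.2
         * (\1_A p.2)%:E)%E.
    rewrite (_ : (fun t => _) = fubini_F m g).
      apply: measurable_fun_fubini_tonelli_F.
        apply: emeasurable_funM; first exact: measurable_discount_transition.
        by apply/measurable_EFinP; exact: measurableT_comp.
      move=> p; apply: mule_ge0; last by rewrite lee_fin indicE.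
      by apply: mule_ge0; [rewrite lee_fin discount_ge0|exact: transition_ge0].
    apply/funext => t; rewrite /fubini_F /g/= /Z integral_mkcond -ge0_integralZl//.
    - apply: eq_integral => x _; rewrite -muleA; congr (_ * _)%E.
      by rewrite patchE indicE; case: ifP; rewrite ?mule1 ?mule0.
    - apply/(measurable_restrictT _ mA).
      apply: measurable_funTS; exact: measurable_transition.
    - by move=> x _; rewrite patchE; case: ifP => // _; exact: transition_ge0.
    - by rewrite lee_fin discount_ge0.
  have ZM t : (Z t <= M%:E * m A)%E.
    rewrite /Z -integral_cst//; apply: ge0_le_integral => //.
    - by move=> x _; exact: transition_ge0.
    - by apply: measurable_funTS; exact: measurable_transition.
    - move=> x _.
      have ef0 (z : Ed) : (0 <= ext0 (EFin \o f) z)%E by case: z.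
      have M0 : 0 <= M by have /andP[/le_trans h /h] := fM x.
      apply: (@le_trans _ _ (\int[P (Some x)]_w M%:E)%E).
        apply: ge0_le_integral => //.
        + exact: (measurableT_comp (measurable_ext0 mEf) (measurable_process Hhunt (pos_ge0 t))).
        + by move=> w _; case: (X _ w) => [y|] /=; rewrite lee_fin//; case/andP: (fM y).
      rewrite integral_cst// -[leRHS]mule1; apply: lee_wpmul2l.
        by rewrite lee_fin.
      exact: probability_le1.
  (* [Rintegral] is [fine] of an integral and would be 0 on an infinite one, so finiteness has to
     precede the identification. *)
  have fin : (\int[lebesgue_measure]_t ((discount a t)%:E * Z t) < +oo)%E.
    apply: (@le_lt_trans _ _ (\int[lebesgue_measure]_t ((discount a t)%:E * (M%:E * m A)))%E).
      apply: ge0_le_integral => //.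
      - by move=> t _; rewrite mule_ge0// lee_fin discount_ge0.
      - apply: emeasurable_funM; last exact: measurable_cst.
        by apply/measurable_EFinP; exact: measurable_discount.
      - by move=> t _; apply: lee_wpmul2l => //; rewrite lee_fin discount_ge0.
    apply: lt_integral_discount => //.
    have M0 : 0 <= M by have /andP[/le_trans h /h] := fM point.
    by rewrite mule_ge0//= lte_mul_pinfty.
  have E1 : (\int[lebesgue_measure]_t ((discount a t)%:E * Z t) =
      \int[lebesgue_measure]_(t in `[0%R, +oo[)
         (expR (- a * t) * L2dot m (T t f) \1_A)%:E)%E.
    rewrite -(@integral_discount a Z)//.
    (* [ZT] is available for [0 < t] only, so the endpoint 0, a null set, is removed. *)
    have mZ' : measurable_fun (`]0%R, +oo[%classic : set R) (fun t => (expR (- a * t))%:E * Z t)%E.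
      apply: (@eq_measurable_fun _ _ _ _ _ (fun t => (discount a t)%:E * Z t)%E).
        move=> t; rewrite inE/= in_itv/= andbT => t0; rewrite /discount indicE.
        by rewrite mem_set ?mulr1//= in_itv/= andbT ltW.
      exact: measurable_funTS.
    have eqZ t : t \in `]0%R, +oo[%classic -> ((expR (- a * t))%:E * Z t =
       (expR (- a * t) * L2dot m (T t f) \1_A)%:E)%E.
      by rewrite inE/= in_itv/= andbT => t0; rewrite ZT// EFinM.
    rewrite -!integral_itv_obnd_cbnd//; first exact: eq_integral.
    exact: (eq_measurable_fun _ eqZ mZ').
  by rewrite E1 /Rintegral fineK// ge0_fin_numE -E1// integral_ge0// => t _;
    rewrite mule_ge0// lee_fin discount_ge0.
have [A_ AT Afin] := sigma_finiteT m.
have aeA i : {ae m, forall x, A_ i x -> resolvent X P a (EFin \o f) x = (G x)%:E}.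
  have [mAi Aify] := Afin i.
  have : ae_eq m (A_ i) (EFin \o G) (resolvent X P a (EFin \o f)).
    apply: integral_ae_eq => //.
    - exact: (L2_integrable_on mAi Aify lG).1.
    - by apply: measurable_funTS; exact: measurable_resolvent.
    - move=> C CA mC; apply: key => //.
      by apply: le_lt_trans Aify; apply: le_measure => //; rewrite inE.
  by apply: ae_imp => x h Ax; rewrite -h.
apply: ae_imp (ae_foralln aeA) => x h.
have : [set: borel E] x by [].
by rewrite AT => -[i _ Aix]; exact: (h i).
Qed.

End AssociatedResolvent.

End Resolvent.

(** * Extraction of subsequences *)

Lemma sum_half_pow (R : realFieldType) n :
  \sum_(0 <= k < n) 2^-1 ^+ k = 2 - 2 * 2^-1 ^+ n :> R.
Proof.
elim: n => [|n IH]; first by rewrite big_geq// expr0 mulr1 subrr.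
by rewrite big_nat_recr//= IH exprS; field.
Qed.

(* AM-GM: [2 |d_k| <= 2^-k + 2^k d_k^2]. *)
Lemma cvg_series_of_weighted_squares {R : realType} (u : nat -> R) (C : R) :
  (forall n, \sum_(0 <= k < n) (2 ^+ k * (u k.+1 - u k) ^+ 2) <= C) -> cvgn u.
Proof.
move=> uC; pose d k := u k.+1 - u k.
have cd : cvgn (series d).
  apply: normed_cvg; apply: nondecreasing_is_cvgn.
    apply/nondecreasing_seqP => n /=.
    by rewrite /series/= big_nat_recr//= lerDl.
  exists ((2 + C) / 2) => _ [n _ <-]; rewrite /series/=.
  apply: (@le_trans _ _
      (\sum_(0 <= k < n) ((2^-1 ^+ k + 2 ^+ k * d k ^+ 2) / 2))); last first.
    rewrite -mulr_suml ler_pM2r// big_split/= lerD// sum_half_pow.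
    by rewrite gerBl mulr_ge0// exprn_ge0.
  apply: ler_sum => k _; rewrite ler_pdivlMr//.
  have pq : 2^-1 ^+ k * 2 ^+ k = 1 :> R by rewrite -exprMn mulVf// expr1n.
  have : 0 <= 2^-1 ^+ k * (1 - 2 ^+ k * `|d k|) ^+ 2.
    by rewrite mulr_ge0 ?sqr_ge0// exprn_ge0// invr_ge0.
  rewrite -(real_normK (num_real (d k))).
  rewrite (_ : 2^-1 ^+ k * _ ^+ 2 = 2^-1 ^+ k - 2 * (2^-1 ^+ k * 2 ^+ k) * `|d k|
     + (2^-1 ^+ k * 2 ^+ k) * 2 ^+ k * `|d k| ^+ 2); last by ring.
  rewrite pq; lra.
rewrite (_ : u = (fun n => u 0%N + series d n)); last first.
  by apply/funext => n; rewrite /series/= telescope_sumr// addrC subrK.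
by apply: is_cvgD => //; exact: is_cvg_cst.
Qed.

Lemma increasing_ge (phi : nat -> nat) : {homo phi : i j / (i < j)%N} ->
  forall n, (n <= phi n)%N.
Proof. by move=> h; elim=> // n IH; apply: (leq_ltn_trans IH); exact: h. Qed.

(* In the second hypothesis [chi'] need not be a subsequence of [chi], even
   eventually: [k] is not required to increase with [n]. *)
Lemma diagonal_extraction (Q : nat -> (nat -> nat) -> Prop) :
  (forall j (psi : nat -> nat), {homo psi : i k / (i < k)%N} ->
     exists2 phi : nat -> nat, {homo phi : i k / (i < k)%N} & Q j (psi \o phi)) ->
  (forall j chi chi', Q j chi ->
     (exists N, forall n, (N <= n)%N -> exists2 k, (n <= k)%N & chi' n = chi k) ->
     Q j chi') ->
  exists2 chi : nat -> nat, {homo chi : i k / (i < k)%N} & forall j, Q j chi.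
Proof.
move=> Qex Qtail.
(* Strict monotonicity travels with the sequence, since each extraction step requires it. *)
pose ST := {psi : nat -> nat | {homo psi : i k / (i < k)%N}}.
have /choice[step stepP] : forall a : nat * ST, exists phi : nat -> nat,
    {homo phi : i k / (i < k)%N} /\ Q a.1 (proj1_sig a.2 \o phi).
  by move=> [j [psi hpsi]]; have [phi h1 h2] := Qex j psi hpsi; exists phi.
have comp_homo (f g : nat -> nat) : {homo f : i k / (i < k)%N} ->
    {homo g : i k / (i < k)%N} -> {homo (f \o g) : i k / (i < k)%N}.
  by move=> hf hg i k ik; apply: hf; exact: hg.
pose next (j : nat) (psi : ST) : ST :=
  exist _ (proj1_sig psi \o step (j, psi))
    (comp_homo _ _ (proj2_sig psi) (stepP (j, psi)).1).
have id_homo : {homo (@id nat) : i k / (i < k)%N} by [].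
pose id0 : ST := exist _ id id_homo.
pose Psi := fix Psi n : ST := if n is k.+1 then next k (Psi k) else id0.
pose psi n := proj1_sig (Psi n).
have psi_homo n : {homo psi n : i k / (i < k)%N} by exact: (proj2_sig (Psi n)).
have psiS n i : exists2 k, (i <= k)%N & psi n.+1 i = psi n k.
  exists (step (n, Psi n) i) => //.
  exact: (increasing_ge (stepP (n, Psi n)).1).
have psiD j e i : exists2 k, (i <= k)%N & psi (j + e)%N i = psi j k.
  elim: e i => [|e IH] i; first by exists i; rewrite ?addn0.
  rewrite addnS; have [k ik ->] := psiS (j + e)%N i.
  by have [l kl ->] := IH k; exists l => //; exact: leq_trans kl.
exists (fun n => psi n n).
  apply: homo_ltn => [? ? ?|n]; first exact: ltn_trans.
  have [k nk ->] := psiS n n.+1; exact: psi_homo.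
(* [psi j.+1] is the first sequence extracted for [Q j], and the diagonal term of rank [n] is one of
   its terms once [j.+1 <= n]. *)
move=> j; apply: (Qtail j (psi j.+1)); first exact: (stepP (j, Psi j)).2.
exists j.+1 => n jn; have [k nk E1] := psiD j.+1 (n - j.+1)%N n.
by exists k => //; rewrite -E1 subnKC.
Qed.

Section CauchySubsequence.
Context {R : realType} {E : pmetricType R}.
Variable m : {measure set (borel E) -> \bar R}.

(** Successive squared distances are kept below [4^-k], so that with weights [2^k] their sum is
    still finite. The weighted sum of squared increments is thus integrable, hence finite a.e.,
    which forces pointwise convergence. *)
Lemma L2_cauchy_ae_subsequence (v : nat -> E -> R) :
  (forall n, L2 m (v n)) ->
  (forall e, 0 < e -> exists N, forall i j, (N <= i)%N -> (N <= j)%N ->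
     L2dot m (v i \- v j) (v i \- v j) < e) ->
  exists2 phi : nat -> nat, {homo phi : i j / (i < j)%N} &
    {ae m, forall x, cvgn (fun n => v (phi n) x)}.
Proof.
move=> lv cv.
have /choice[N NP] : forall k : nat, exists N, forall i j, (N <= i)%N -> (N <= j)%N ->
    L2dot m (v i \- v j) (v i \- v j) < (2^-1 ^+ k) ^+ 2.
  by move=> k; apply: cv; rewrite !exprn_gt0// invr_gt0.
pose phi := fix phi k := if k is j.+1 then maxn (N j.+1) (phi j).+1 else N 0%N.
have Nphi k : (N k <= phi k)%N by case: k => //= k; exact: leq_maxl.
have phiS k : (phi k < phi k.+1)%N by exact: leq_maxr.
have phi_homo : {homo phi : i j / (i < j)%N}.
  by apply: homo_ltn => //; exact: ltn_trans.
exists phi => //.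
pose dk k x := v (phi k.+1) x - v (phi k) x.
have ldk k : L2 m (dk k) by exact: L2B.
pose h k x := (2 ^+ k * dk k x ^+ 2)%:E.
have h0 k x : (0 <= h k x)%E by rewrite lee_fin mulr_ge0 ?sqr_ge0// exprn_ge0.
have mh k : measurable_fun [set: borel E] (h k).
  apply/measurable_EFinP; apply: measurable_funM => //.
  by apply: measurable_funX; exact: (L2_measurable (ldk k)).
have ih k : (\int[m]_x h k x <= (2^-1 ^+ k)%:E)%E.
  rewrite (_ : \int[m]_x h k x = (2 ^+ k * L2dot m (dk k) (dk k))%:E)%E.
    rewrite lee_fin; have := NP k (phi k.+1) (phi k)
      (leq_trans (Nphi k) (ltnW (phiS k))) (Nphi k).
    move=> /ltW; rewrite -/(dk k) => H.
    apply: (@le_trans _ _ (2 ^+ k * (2^-1 ^+ k) ^+ 2)).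
      by rewrite ler_pM2l// exprn_gt0.
    by rewrite expr2 mulrA -exprMn divff// expr1n mul1r.
  rewrite EFinM /L2dot /Rintegral fineK; last first.
    by apply: integrable_fin_num => //; exact: L2_mul_integrable.
  rewrite -ge0_integralZl//.
  - by apply/measurable_EFinP; apply: measurable_funM; exact: (L2_measurable (ldk k)).
  - by move=> x _; rewrite lee_fin -expr2 sqr_ge0.
have mH : measurable_fun [set: borel E] (fun x => \sum_(0 <= k <oo) h k x)%E.
  by apply: ge0_emeasurable_sum.
have iH : m.-integrable [set: borel E] (fun x => \sum_(0 <= k <oo) h k x)%E.
  apply/integrableP; split => //.
  under eq_integral do rewrite gee0_abs ?nneseries_ge0//.
  rewrite integral_nneseries//; apply: (@le_lt_trans _ _ 2%:E); last exact: ltry.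
  apply: lime_le.
    by apply: is_cvg_nneseries => n _ _; exact: integral_ge0.
  apply: nearW => n; apply: (@le_trans _ _ (\sum_(0 <= k < n) (2^-1 ^+ k)%:E)%E).
    exact: lee_sum.
  rewrite sumEFin lee_fin sum_half_pow gerBl mulr_ge0// exprn_ge0// invr_ge0//.
have := integrable_ae measurableT iH.
apply: ae_imp => x /(_ Logic.I) fx.
pose C := fine (\sum_(0 <= k <oo) h k x)%E.
apply: (@cvg_series_of_weighted_squares _ _ C) => n.
rewrite -lee_fin /C fineK// -sumEFin.
by apply: nneseries_lim_ge => k _ _; exact: (h0 k x).
Qed.

End CauchySubsequence.

(** * Bump functions in the domain and sigma-finiteness *)

Section Exhaustion.
Context {R : realType} {E : pmetricType R}.
Variable m : {measure set (borel E) -> \bar R}.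
Variables (D : set (E -> R)) (B : (E -> R) -> (E -> R) -> R) (a0 : R).
Hypothesis HE : lcs_space E.
Hypothesis Hform : semi_dirichlet_form m D B a0.
Hypothesis Hreg : regular_form m D B a0.

Lemma mdist_continuous (s : E) : continuous (mdist s).
Proof.
move=> x; apply/cvgrPdist_lt => e e0.
near=> y.
have xy : mdist x y < e.
  have : ball x e y by near: y; exact: nbhsx_ballx.
  by rewrite ballEmdist.
rewrite (le_lt_trans _ xy)// ler_norml.
have := metric_triangle s x y; have := metric_triangle s y x.
rewrite (metric_sym y x); lra.
Unshelve. all: by end_near. Qed.

(** The lower bound [2^-1] is what remains of a function at least 1 after a uniform approximation
    with error less than [2^-1]. *)
Definition bump (s : E) (n : nat) (rho : E -> R) : Prop :=
  [/\ D rho, forall x, 0 <= rho x <= 1 &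
    forall x, mdist s x < n.+1%:R^-1 -> 2^-1 <= rho x].

Lemma bump_exists (s : E) (n : nat) :
  compact [set y | mdist s y <= 2 / n.+1%:R] -> exists rho, bump s n rho.
Proof.
(* This tent is at least 1 on the ball of radius [1 / n.+1] and vanishes outside the closed ball of
   radius [2 / n.+1], which is compact by hypothesis. *)
move=> cQ; pose f (y : E) := Num.max (2 - n.+1%:R * mdist s y) 0.
have cf : continuous f.
  move=> y; apply: cvg_maxr_cst; apply: cvgB; first exact: cvg_cst.
  by apply: cvgM; [exact: cvg_cst|exact: mdist_continuous].
have [C [CD _ Capp]] := Hreg.
have Cf : Cc f.
  split => //; apply: (subclosed_compact _ cQ); first exact: closed_closure.
  have clQ : closed [set y | mdist s y <= 2 / n.+1%:R].
    rewrite (_ : [set y | _] = mdist s @^-1` [set r | r <= 2 / n.+1%:R])//.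
    by apply: closed_comp; [move=> x _; exact: mdist_continuous|exact: closed_le].
  rewrite [X in _ `<=` X]((closure_id _).1 clQ).
  apply: closureS => y /=; rewrite /f => fy.
  rewrite ler_pdivlMr// mulrC leNgt; apply/negP => h.
  by move: fy; rewrite max_r ?eqxx// subr_le0 ltW.
have half_gt0 : (0 : R) < 2^-1 by rewrite invr_gt0.
have [w Cw fw] := Capp f Cf 2^-1 half_gt0.
have [_ Dw] := CD w Cw.
have HB := sdf_bilinear Hform.
have Dw0 : D (fun x => Num.max (w x) 0).
  have [Dm _] := sdf_contraction Hform Dw (lexx 0).
  have -> : (fun x => Num.max (w x) 0) = w \- (fun x => Num.min (w x) 0).
    apply/funext => x /=.
    by rewrite /Num.min/Num.max; case: ifP; rewrite ?subrr ?subr0.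
  exact: (form_domB HB).
have [Dw1 _] := sdf_contraction Hform Dw0 ler01.
exists (fun x => Num.min (Num.max (w x) 0) 1); split => //.
  by move=> x; rewrite le_min ler01 le_max lexx orbT/= ge_min lexx orbT.
move=> x sx; rewrite le_min le_max.
have f1 : 1 <= f x.
  rewrite /f le_max; apply/orP; left.
  have : n.+1%:R * mdist s x <= 1 by rewrite mulrC -ler_pdivlMr// div1r ltW.
  lra.
have := fw x; rewrite ltr_norml => /andP[h1 h2].
apply/andP; split; last lra.
apply/orP; left; lra.
Qed.

Lemma bump_cover : exists rho : nat -> E -> R,
  [/\ forall i, D (rho i), forall i x, 0 <= rho i x <= 1 &
     forall x, exists i, 2^-1 <= rho i x].
Proof.
have [HEc [S cS dS]] := HE.
have D0 := bf_dom0 (sdf_bilinear Hform).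
have [S0|[s_]] : S = set0 \/ $| {surjfun [set: nat] >-> S} |.
- exact/pfcard_geP.
- have [x [_]] := dS setT (ex_intro _ point Logic.I) openT.
  by rewrite S0.
(* A pair gives a centre in the dense sequence and a radius; where no bump exists, zero is a
   harmless default. *)
have /choice[r rP] : forall p : nat * nat, exists rho : E -> R,
    [/\ D rho, forall x, 0 <= rho x <= 1 &
      (exists rho', bump (s_ p.1) p.2 rho') -> bump (s_ p.1) p.2 rho].
  move=> p; have [[rho hrho]|nr] := pselect (exists rho', bump (s_ p.1) p.2 rho').
    by exists rho; have [h1 h2 h3] := hrho; split.
  by exists (fun=> 0); split => // x; rewrite lexx ler01.
exists (fun i => r (odflt (0%N, 0%N) (unpickle i))); split.
- by move=> i; have [] := rP (odflt (0%N, 0%N) (unpickle i)).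
- by move=> i x; have [_ h _] := rP (odflt (0%N, 0%N) (unpickle i)); exact: h.
move=> x; have [K Kx [cK _]] := HEc x Logic.I.
have /nbhs_ballP[e /= e0 eK] : nbhs x K.
  have Kx' : {near nbhs x, [set: E] `<=` K} := Kx.
  by near=> y; apply: (near Kx' y).

(* The factor 3 is 1 + 2: the closed ball of radius [2 / n.+1] around a centre within [1 / n.+1] of
   [x] stays within [e] of [x], hence in the compact [K]. *)
pose n := Num.truncn (3 / e).
have n3 : 3 * n.+1%:R^-1 < e.
  rewrite ltr_pdivrMr// mulrC -ltr_pdivrMr//.
  by have /andP[] := @truncn_itv _ (3 / e) (divr_ge0 (ler0n _ _) (ltW e0)).
have n0 : (0 : R) < n.+1%:R^-1 by rewrite invr_gt0.
have [s [xs Ss]] : ball x n.+1%:R^-1 `&` S !=set0.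
  have [t [bt tS]] : interior (ball x n.+1%:R^-1) `&` S !=set0.
    apply: dS; last exact: open_interior.
    by exists x; apply: nbhs_singleton; apply: nbhs_interior; exact: nbhsx_ballx.
  by exists t; split => //; exact: interior_subset.
have [i _ si] := @surj _ _ _ _ s_ s Ss.
exists (pickle (i, n)); rewrite pickleK /=.
move: xs; rewrite ballEmdist/= => xs.
have [_ _ h] := rP (i, n).
have [] := h; last first.
  move=> _ _; apply; rewrite /= si metric_sym//.
rewrite /= si; apply: bump_exists.
apply: (subclosed_compact _ cK).
  rewrite (_ : [set y | _] = mdist s @^-1` [set r | r <= 2 / n.+1%:R])//.
  by apply: closed_comp; [move=> y _; exact: mdist_continuous|exact: closed_le].
move=> y /= sy; apply: eK; rewrite ballEmdist/=.
apply: (le_lt_trans (metric_triangle x s y)); apply: le_lt_trans n3.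
rewrite (_ : 3 = 1 + 2) // mulrDl mul1r; apply: lerD => //; exact: ltW.
Unshelve. all: by end_near. Qed.

(** The sets where some [rho i] is at least [2^-1] cover the space, and their indicators are bounded
    by the square integrable [2 * rho i]. *)
Lemma sigma_finite_of_bump_cover : sigma_finite [set: borel E] m.
Proof.
have [rho [Drho rho01 rhoc]] := bump_cover.
have lrho i : L2 m (rho i) by exact: (sdf_sub_L2 Hform).
pose A i : set (borel E) := rho i @^-1` `[2^-1, +oo[.
have mA i : measurable (A i).
  rewrite -[X in measurable X]setTI; apply: (L2_measurable (lrho i)) => //.
exists A.
  apply/seteqP; split => // x _; have [i hi] := rhoc x.
  by exists i => //; rewrite /A/= in_itv/= hi.
move=> i; split; first exact: mA.
have lA : L2 m (\1_(A i) : E -> R).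
  apply: (L2_le _ (L2Z 2 (lrho i))); first exact: measurable_indic.
  move=> x; have /andP[h1 h2] := rho01 i x.
  rewrite indicE; case: (boolP (x \in A i)) => [|_]; last by rewrite normr0.
  rewrite inE /A/= in_itv/= andbT => h3.
  by rewrite normr1 ger0_norm; lra.
have /integrableP[_] := L2_mul_integrable lA lA.
apply: le_lt_trans; rewrite -[in leLHS](setIT (A i)) -integral_indic//.
rewrite le_eqVlt; apply/orP; left; apply/eqP; apply: eq_integral => x _ /=.
by rewrite indicE; case: (x \in A i); rewrite ?mulr1 ?mulr0 ?normr1 ?normr0.
Qed.

End Exhaustion.

(** * Comparison of resolvents and convergence of the truncated sequence *)

Section ResolventMonotone.
Context {R : realType} {E : pmetricType R}.
Context {d : measure_display} {Omega : measurableType d}.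
Variables (X : R -> Omega -> cemetery_ext E).
Variable P : cemetery_ext E -> probability Omega R.
Variable F : R -> set (set Omega).
Hypothesis Hhunt : hunt_process X P F.

Lemma le_resolvent (f g : E -> \bar R) a x :
  measurable_fun [set: borel E] f -> measurable_fun [set: borel E] g ->
  (forall y, 0 <= f y)%E -> (forall y, f y <= g y)%E ->
  (resolvent X P a f x <= resolvent X P a g x)%E.
Proof.
move=> mf mg f0 fg.
have g0 y : (0 <= g y)%E by apply: le_trans (fg y).
have e0 (h : E -> \bar R) (h0 : forall y, (0 <= h y)%E) z : (0 <= ext0 h z)%E by case: z.
rewrite !(resolventE Hhunt)//; apply: ge0_le_integral => //.
- move=> t _; apply: mule_ge0; first by rewrite lee_fin discount_ge0.
  exact: transition_ge0.
- have H := measurable_fun_pair1 (x : borel E) (measurable_discount_transition Hhunt mf f0 a).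
  exact: H.
- have H := measurable_fun_pair1 (x : borel E) (measurable_discount_transition Hhunt mg g0 a).
  exact: H.
- move=> t _; apply: lee_wpmul2l; first by rewrite lee_fin discount_ge0.
  have t0 : 0 <= Num.max t 0 by rewrite le_max lexx orbT.
  apply: ge0_le_integral => //.
  + by move=> w _; exact: e0.
  + exact: (measurableT_comp (measurable_ext0 mf) (measurable_process Hhunt t0)).
  + exact: (measurableT_comp (measurable_ext0 mg) (measurable_process Hhunt t0)).
  + by move=> w _; case: (X _ w) => //=.
Qed.

End ResolventMonotone.

Section TruncatedSequence.
Context {R : realType} {E : pmetricType R}.
Variable m : {sigma_finite_measure set (borel E) -> \bar R}.
Variables (D : set (E -> R)) (B : (E -> R) -> (E -> R) -> R) (a0 : R).
Hypothesis Hform : semi_dirichlet_form m D B a0.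
Hypothesis Hpos : positive_form m D B.
Context {d : measure_display} {Omega : measurableType d}.
Variable X : R -> Omega -> cemetery_ext E.
Variable P : cemetery_ext E -> probability Omega R.
Variable F : R -> set (set Omega).
Hypothesis Hhunt : hunt_process X P F.
Hypothesis Hassoc : associated X P m D B a0.

Lemma resolvent_L2_cauchy (a e : R) (v G : nat -> E -> R) (rho Gamma : E -> R) :
  (forall n, measurable_fun [set: borel E] (v n)) ->
  measurable_fun [set: borel E] rho ->
  (forall n x, 0 <= v n x <= rho x) ->
  (forall n, L2 m (G n)) -> L2 m Gamma ->
  (forall n, {ae m, forall x, resolvent X P a (EFin \o v n) x = (G n x)%:E}) ->
  {ae m, forall x, resolvent X P a (EFin \o rho) x = (Gamma x)%:E} ->
  ae_cvg_finite m (fun n => resolvent X P a (EFin \o v n)) ->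
  0 < e ->
  exists2 L : E -> R, L2 m L & exists N, forall n, (N <= n)%N ->
    L2dot m (G n \- L) (G n \- L) < e.
Proof.
move=> mv mrho vrho lG lGam RG RGam Rcvg e0.
have mG n := L2_measurable (lG n); have mGam := L2_measurable lGam.
(* Truncating the limit to [[0, Gamma]] makes it square integrable without a
   null set; the truncation is inactive a.e. *)
pose ls x := fine (limn_esup (fun n => (G n x)%:E)).
pose L x := Num.max (Num.min (ls x) (Gamma x)) 0.
have mL : measurable_fun [set: borel E] L.
  apply: measurable_maxr => //; apply: measurable_minr => //.
  apply: measurableT_comp => //.
  by apply: measurable_fun_limn_esup => n; exact/measurable_EFinP.
have lL : L2 m L.
  apply: (L2_le mL lGam) => x; rewrite /L.
  have [G0|G0] := leP 0 (Gamma x).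
    rewrite ger0_norm ?le_max ?lexx ?orbT// [leRHS]ger0_norm//.
    by rewrite ge_max G0 andbT ge_min lexx orbT.
  by rewrite max_r ?normr0// ge_min (ltW G0) orbT.
have key : {ae m, forall x, G n x @[n --> \oo] --> L x /\
    (forall n, 0 <= G n x <= Gamma x) /\ 0 <= L x <= Gamma x}.
  have RG' := ae_foralln RG.
  have := ae_imp2 (fun x h1 h2 => conj h1 h2) RG' RGam.
  apply: (ae_imp2 _ Rcvg) => x [cR finR] [hG hGam].
  have GG n : 0 <= G n x <= Gamma x.
    have v0 y : (0 <= (EFin \o v n) y)%E by rewrite lee_fin; have /andP[] := vrho n y.
    have mEv : measurable_fun [set: borel E] (EFin \o v n) by exact/measurable_EFinP.
    rewrite -!lee_fin -hG -hGam (resolvent_ge0 Hhunt)//=.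
    apply: (le_resolvent Hhunt) => //.
    - exact/measurable_EFinP.
    - by move=> y; rewrite lee_fin; have /andP[] := vrho n y.
  have EG : (fun n => resolvent X P a (EFin \o v n) x) = (fun n => (G n x)%:E).
    by apply/funext => n; rewrite hG.
  rewrite EG in cR finR.
  set l := fine (lim ((G n x)%:E @[n --> \oo])).
  have Gl : G n x @[n --> \oo] --> l.
    have Gl' : ((G n x)%:E @[n --> \oo] --> l%:E)%E by rewrite /l fineK//; exact: cR.
    exact: (fine_cvg Gl').
  have lsl : ls x = l by rewrite /ls is_cvg_limn_esupE.
  have l0 : 0 <= l.
    by apply: (cvgr_to_ge Gl); apply: nearW => n; have /andP[] := GG n.
  have lG' : l <= Gamma x.
    by apply: (cvgr_to_le Gl); apply: nearW => n; have /andP[] := GG n.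
  have -> : L x = l by rewrite /L lsl min_l// max_l.
  by rewrite l0 lG'.
have cvgL : L2dot m (G n \- L) (G n \- L) @[n --> \oo] --> 0.
  apply: (L2dot_dominated_cvg0 (h := Gamma)) => //.
  - by move=> n; exact: measurable_funB.
  - apply: ae_imp key => x [Gx _]; rewrite -[X in _ --> X](subrr (L x)).
    by apply: cvgB => //; exact: cvg_cst.
  - apply: ae_imp key => x [_ [Gx Lx]] n /=; have := Gx n.
    rewrite ler_norml; lra.
exists L => //.
have /cvgrPdist_lt/(_ e e0) [N _ HN] := cvgL.
exists N => n Nn; have := HN n Nn.
by rewrite sub0r normrN => /(le_lt_trans (ler_norm _)).
Qed.

Variable Be : (E -> R) -> (E -> R) -> R.
Hypothesis Hext : extended_form m D B Be.
Variable PP : set (E -> \bar R).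
Hypothesis HP1 : property_P1 PP.
Hypothesis Hcomp : compactness_property X P m PP.

Lemma truncated_extraction (u : nat -> E -> R) (C M : R) (rho : E -> R) :
  (forall n, extended_space m D B (u n)) ->
  (forall n x, 0 <= u n x) ->
  (forall n, PP (EFin \o u n)) ->
  (forall n, Be (u n) (u n) <= C) ->
  D rho -> (forall x, 0 <= rho x <= M) ->
  exists2 phi : nat -> nat, {homo phi : i j / (i < j)%N} &
    {ae m, forall x, cvgn (fun n => Num.min (u (phi n) x) (rho x))}.
Proof.
move=> HuF u0 HuP HuC Drho rhoM.
have [K K0 sec] := positive_form_sector Hform Hpos Hext.
have HB := sdf_bilinear Hform.
have DL2 := sdf_sub_L2 Hform.
have rho0 x : 0 <= rho x by have /andP[] := rhoM x.
have mrho := bf_measurable HB Drho.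
pose v n x := Num.min (u n x) (rho x).
have vrho n x : 0 <= v n x <= rho x by rewrite le_min u0 rho0 ge_min lexx orbT.
have mu n : measurable_fun [set: borel E] (u n) by case: (HuF n).
have mv n : measurable_fun [set: borel E] (v n) by exact: measurable_minr.
have lv n : L2 m (v n).
  apply: (L2_le (mv n) (DL2 _ Drho)) => x; have /andP[h1 h2] := vrho n x.
  by rewrite !ger0_norm.
have PPv n : PP (EFin \o v n).
  apply: (HP1 (HuP n)); first split.
  - exact/measurable_EFinP.
  - by move=> x; rewrite lee_fin; have /andP[] := vrho n x.
  - by move=> x; rewrite lee_fin ge_min lexx.
have [Lam [psi [Lpos Lsup psih Lcvg]]] := Hcomp PPv.
pose C' := truncation_bound K (2 + 2 * C) (B rho rho).
have approx n e : 0 < e -> exists z, [/\ D z, B z z <= C' & L2dot m (v n \- z) (v n \- z) < e].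
  move=> e0.
  exact: (truncation_approx Hform Hpos Hext K0 sec (HuF n) (u0 n) (HuC n) Drho rho0 e0).
have a0_ge0 := sdf_a0_ge0 Hform.
have [|phi phih cphi] := @L2_cauchy_ae_subsequence _ _ m (fun n => v (psi n)) (fun n => lv _).
  move=> e e0.
  (* The subsequence [psi] serves every [a] in [Lam], so [a] may be chosen after [e]. It must exceed
     [a0] for [fsg_resolvent] to apply, and 128 yields the residual bound
     [4 * (e / 128) + e / 32 = e / 16]. *)
  have [a La [a0a aC]] : exists2 a, Lam a & a0 < a /\ K * C' / a < e / 128.
    pose b := Num.max a0 (K * C' * 128 / e).
    have [|_ [a La <-]] := @ereal_sup_gt _ [set a%:E | a in Lam] b%:E.
      by rewrite Lsup ltry.
    rewrite lte_fin gt_max => /andP[a0a aC]; exists a => //; split => //.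
    have a_gt0 : 0 < a by exact: Lpos.
    rewrite ltr_pdivrMr//; move: aC; rewrite ltr_pdivrMr//; lra.
  have a_gt0 : 0 < a by exact: Lpos.
  have resP f : L2 m f -> exists2 g', D g' &
      forall w, D w -> B g' w + a * L2dot m g' w = L2dot m f w.
    move=> lf; have [T HT _] := Hassoc.
    by have [g [Dg Hg _]] := fsg_resolvent HT a0a lf; exists g.
  have /choice[G GP] : forall n, exists G, [/\ D G,
      forall w, D w -> B G w + a * L2dot m G w = L2dot m (v n) w &
      {ae m, forall x, resolvent X P a (EFin \o v n) x = (G x)%:E}].
    move=> n; apply: (resolvent_associated Hhunt DL2 a0_ge0 Hassoc (M := M)) => // x.
    by have /andP[-> /le_trans] := vrho n x; apply; have /andP[] := rhoM x.
  have [Gam [DGam _ RGam]] := resolvent_associated Hhunt DL2 a0_ge0 Hassoc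
    a0a (DL2 _ Drho) rhoM.
  have DG n : D (G n) by case: (GP n).
  have HG n w : D w -> B (G n) w + a * L2dot m (G n) w = L2dot m (v n) w.
    by case: (GP n) => _ + _; exact.
  have RG n : {ae m, forall x, resolvent X P a (EFin \o v n) x = (G n x)%:E}.
    by case: (GP n).
  have lG n : L2 m (G n) by exact: DL2.
  pose r n := v n \- (fun x => a * G n x).
  have lr n : L2 m (r n) by apply: L2B => //; exact: L2Z.
  have qr n : L2dot m (r n) (r n) <= e / 16.
    have e8 : 0 < e / 32 by rewrite divr_gt0.
    have := resolvent_residual_approx HB (positive_form_ge0 Hpos) K0 sec DL2 a_gt0
      (lv n) (DG n) (HG n) resP (approx n) e8.
    rewrite -/(r n); lra.
  have ea : 0 < e / 32 / a ^+ 2 by rewrite !divr_gt0// exprn_gt0.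
  have [L lL [N HN]] := resolvent_L2_cauchy (fun n => mv (psi n)) mrho
    (fun n => vrho (psi n)) (fun n => lG (psi n)) (DL2 _ DGam)
    (fun n => RG (psi n)) RGam (Lcvg a La) ea.
  pose s n x := a * (G (psi n) \- L) x.
  have ls n : L2 m (s n) by apply: L2Z; exact: L2B.
  have qs n : (N <= n)%N -> L2dot m (s n) (s n) < e / 32.
    move=> Nn; rewrite L2dot_sqrZ; last exact: L2B.
    by rewrite mulrC -ltr_pdivlMr ?exprn_gt0//; exact: HN.
  (* The sum is [v (psi n)] minus [a * L], with the same [L] for all [n]. Its squared norm is at
     most [2 * (e / 16) + 2 * (e / 32)], and differences of two such terms stay below
     [4 * (3 * e / 16) < e]. *)
  have q n : (N <= n)%N ->
      L2dot m (r (psi n) \+ s n) (r (psi n) \+ s n) <= 3 * e / 16.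
    move=> Nn; have := L2dot_sqr_add (lr (psi n)) (ls n).
    have := qr (psi n); have := qs n Nn; lra.
  exists N => i j Ni Nj.
  rewrite (_ : v (psi i) \- v (psi j) =
      (r (psi i) \+ s i) \- (r (psi j) \+ s j)); last first.
    by apply/funext => x; rewrite /r /s /=; ring.
  have := L2dot_sqr_sub (L2D (lr (psi i)) (ls i)) (L2D (lr (psi j)) (ls j)).
  have := q i Ni; have := q j Nj; lra.
exists (psi \o phi) => //.
by move=> i j ij; apply: psih; exact: phih.
Qed.

End TruncatedSequence.

(** * Removal of the truncation *)

Section SigmaFinitePack.
Context {d : measure_display} {T : measurableType d} {R : realType}.
Variables (m : {measure set T -> \bar R}) (sf : sigma_finite [set: T] m).

(* The unused argument gives the instances below access to the proof [sf]. *)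
Definition as_sigma_finite of sigma_finite [set: T] m : set T -> \bar R := m.

HB.instance Definition _ := Measure.copy (as_sigma_finite sf) m.
HB.instance Definition _ :=
  Measure_isSigmaFinite.Build d T R (as_sigma_finite sf) sf.

End SigmaFinitePack.

(** The equality of measures lets hypotheses on a bare measure be rewritten into hypotheses on a
    sigma-finite one, as Tonelli requires. *)
Lemma sigma_finite_measure_pack {d : measure_display} {T : measurableType d}
    {R : realType} (m : {measure set T -> \bar R}) : sigma_finite [set: T] m ->
  exists ms : {sigma_finite_measure set T -> \bar R},
    (ms : {measure set T -> \bar R}) = m.
Proof.
by move=> sf; exists (as_sigma_finite sf); case: m sf => s [] *; reflexivity.
Qed.

Theorem proposition2p11 (R : realType) (E : pmetricType R)
  (m : {measure set (borel E) -> \bar R})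
  (HE : lcs_space E) (Hm : radon_measure m) (Hsupp : full_support m)
  (D : set (E -> R)) (B : (E -> R) -> (E -> R) -> R) (a0 : R)
  (Hform : semi_dirichlet_form m D B a0)
  (Hreg : regular_form m D B a0)
  (Hpos : positive_form m D B)
  (d : measure_display) (Omega : measurableType d)
  (X : R -> Omega -> cemetery_ext E)
  (P : cemetery_ext E -> probability Omega R)
  (F : R -> set (set Omega))
  (Hhunt : hunt_process X P F)
  (Hassoc : associated X P m D B a0)
  (Htrans : transient X P m)
  (Be : (E -> R) -> (E -> R) -> R)
  (Hext : extended_form m D B Be)
  (PP : set (E -> \bar R))
  (HPP : PP `<=` nonneg_borel_real)
  (HP1 : property_P1 PP) (HP2 : property_P2 PP)
  (Hcomp : compactness_property X P m PP)
  (u : nat -> E -> R)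
  (HuF : forall n, extended_space m D B (u n))
  (HuP : forall n, PP (EFin \o u n))
  (Hbound : has_ubound (range (fun n => Be (u n) (u n)))) :
  exists2 phi : nat -> nat, {homo phi : i j / (i < j)%N} &
    ae_cvg_finite m (fun n => EFin \o u (phi n)).
Proof.
have sf := sigma_finite_of_bump_cover HE Hform Hreg.
have [rho [Drho rho01 rhoc]] := bump_cover HE Hform Hreg.
have [ms Ems] := sigma_finite_measure_pack sf.
have [C HC] := Hbound.
have uC n : Be (u n) (u n) <= C by apply: HC; exists n.
have u0 n x : 0 <= u n x.
  by have [[_ /(_ x) h] _] := HPP _ (HuP n); rewrite -lee_fin.
(* All natural multiples of all bumps are enumerated; each is bounded, as the identification of
   resolvents requires. *)
pose ik j := odflt (0%N, 0%N) (unpickle j) : nat * nat.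
pose rk j x := (ik j).2%:R * rho (ik j).1 x.
have Drk j : D (rk j) by exact: (form_domZ (sdf_bilinear Hform)).
have rkM j x : 0 <= rk j x <= (ik j).2%:R.
  have /andP[h1 h2] := rho01 (ik j).1 x.
  by rewrite mulr_ge0//= ler_piMr.
pose Q j (chi : nat -> nat) :=
  {ae m, forall x, cvgn (fun n => Num.min (u (chi n) x) (rk j x))}.
have [j psi _|j chi chi' hQ [N HN]|chi chih Qchi] := @diagonal_extraction Q.
- rewrite /Q -Ems; rewrite -Ems in Hform Hpos Hassoc Hext Hcomp HuF.
  exact: (truncated_extraction Hform Hpos Hhunt Hassoc Hext HP1 Hcomp
    (fun n => HuF (psi n)) (fun n => u0 (psi n)) (fun n => HuP (psi n))
    (fun n => uC (psi n)) (Drk j) (rkM j)).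
- apply: ae_imp hQ => x /cvg_ex[l hl]; apply/cvg_ex; exists l.
  apply/cvgrPdist_lt => e e0.
  have /cvgrPdist_lt/(_ e e0)[N' _ HN'] := hl.
  exists (maxn N N') => // n /=; rewrite geq_max => /andP[Nn N'n].
  have [k nk ->] := HN n Nn; apply: HN'; exact: leq_trans nk.
exists chi => //.
apply: ae_imp (ae_foralln Qchi) => x cx.
have [_ /(_ x) sfin] := HPP _ (HP2 _ HuP).
set S := ereal_sup _ in sfin.
have uS n : u n x <= fine S.
  rewrite -lee_fin fineK//; apply: ereal_sup_ubound; by exists n.
have [i hi] := rhoc x.
(* The factor 2 compensates [2^-1 <= rho i x]: the multiple [k%:R * rho i x] exceeds the supremum,
   so the truncation is inactive at [x] for every [n]. *)
pose k := (Num.truncn (2 * fine S)).+1.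
have kS : 2 * fine S < k%:R.
  have := @truncn_itv _ (2 * fine S) (mulr_ge0 (ler0n _ 2) (le_trans (u0 0%N x) (uS 0%N))).
  by case/andP.
have := cx (pickle (i, k)).
rewrite (_ : (fun n => _) = (fun n => u (chi n) x)); last first.
  apply/funext => n; rewrite min_l// /rk /ik pickleK /=.
  apply: (le_trans (uS _)).
  have : k%:R * 2^-1 <= k%:R * rho i x by rewrite ler_wpM2l.
  lra.
move=> /cvg_ex[l hl].
have El : ((EFin \o u (chi n)) x @[n --> \oo] --> l%:E)%E.
  by apply/fine_cvgP; split; [exact: nearW|exact: hl].
by split; [apply/cvg_ex; exists l%:E|rewrite (cvg_lim _ El)].
Qed.
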